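(* Let $f^1,\ldots,f^d\in\mathcal H^{\odot2}$ and let $\mu$ be the law of the random vector in the second Wiener chaos $X=(\mathcal I^2(f^1),\ldots,\mathcal I^2(f^d))$. Then the moment-generating function $\mathcal M(\theta)=\mathbb E\exp(\theta\cdot X)$ is defined and non-zero on the open polydisc $D_R$ for any $R\in(0,\infty]^d$ such that $$\sum_{k=1}^dR_k\|f^k\|_{\mathcal H^{\odot2}}<\frac1{\sqrt2}.$$
   Context: $\mathcal H$ is a separable real Hilbert space and $W$ a centred isonormal Gaussian process over $\mathcal H$. $\mathcal H^{\odot2}\subset\mathcal H^{\otimes2}$ is the space of symmetric tensors with norm $\|f\|_{\mathcal H^{\odot2}}=\sqrt2\,\|f\|_{\mathcal H^{\otimes2}}$, and $\mathcal I^2\colon\mathcal H^{\odot2}\to L^2(\Omega)$ is the isometry onto the second homogeneous Wiener chaos, normalised so that $\mathcal I^2(h\otimes h)=W(h)^2-\|h\|^2$. For $R\in(0,\infty]^d$, $D_R=\{\theta\in\mathbb C^d:|\theta_i|<R_i\ \forall i\}$. ''$\mathcal M$ is defined on $D_R$'' means $\mathbb E\exp(\sum_kq_k|X^k|)<\infty$ for all $q\in[0,\infty)^d$ with $q_k<R_k$ for all $k$. The convention $\infty\cdot0=0$ is used. *)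

(* Defs.v *)
From HB Require Import structures.
From mathcomp Require Import all_boot all_order all_algebra.
From mathcomp Require Import all_classical all_reals all_analysis.
From mathcomp Require Import complex.

Set Implicit Arguments.
Unset Strict Implicit.
Unset Printing Implicit Defensive.

Import Order.TTheory GRing.Theory Num.Theory.
Import numFieldNormedType.Exports.

Local Open Scope classical_set_scope.
Local Open Scope ring_scope.
Local Open Scope complex_scope.

HB.mixin Record CompleteNormedModule_isRealHilbert (R : realType) H
    of CompleteNormedModule R H := {
  hdot : H -> H -> R ;
  hdotC : forall x y : H, hdot x y = hdot y x ;
  hdot_linearl : forall (a : R) (x y z : H),
    hdot (a *: x + y) z = a * hdot x z + hdot y z ;
  hdotxx : forall x : H, hdot x x = `|x| ^+ 2 }.

#[short(type="realHilbertType")]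
HB.structure Definition RealHilbert (R : realType) :=
  { H of CompleteNormedModule R H & CompleteNormedModule_isRealHilbert R H }.

Definition separable_space (T : topologicalType) : Prop :=
  exists2 S : set T, countable S & dense S.

Section hilbert_tensor_square.
Context {R : realType}.

Definition linear_span (V : lmodType R) (S : set V) : set V :=
  [set x | exists n (c : 'I_n -> R) (v : 'I_n -> V),
    (forall i, S (v i)) /\ x = \sum_(i < n) c i *: v i].

(* [T], with [tens x y] as x (x) y, is a completion of the algebraic tensor
   product of [H] with itself; this determines [(T, tens)] up to a unique
   isometric isomorphism. *)
Definition is_hilbert_tensor_square (H T : realHilbertType R)
    (tens : H -> H -> T) : Prop :=
  [/\ (forall (a : R) x y z, tens (a *: x + y) z = a *: tens x z + tens y z),
      (forall (a : R) x y z, tens z (a *: x + y) = a *: tens z x + tens z y),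
      (forall x y x' y',
         hdot (tens x y) (tens x' y') = hdot x x' * hdot y y') &
      dense (linear_span [set t | exists x y, t = tens x y])].

(* Invariance under the flip x (x) y |-> y (x) x, which is determined by its
   values on pure tensors because these span a dense subspace. *)
Definition symmetric_tensor (H T : realHilbertType R) (tens : H -> H -> T)
    (f : T) : Prop :=
  exists flip : T -> T,
    [/\ linear flip, continuous flip,
        (forall x y, flip (tens x y) = tens y x) & flip f = f].

Definition sym_norm (T : realHilbertType R) (f : T) : R :=
  Num.sqrt 2 * `|f|.

End hilbert_tensor_square.

Section wiener_chaos.
Context {R : realType} {d : measure_display} {Omega : measurableType d}.
Variable P : probability Omega R.

(* The degenerate law is the Dirac mass at 0; it is treated apart because
   [normal_prob m 0] is the uniform law on [0, 1]. *)
Definition centred_gaussian (X : Omega -> R) : Prop :=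
  exists2 s : R, 0 <= s &
    forall A : set R, measurable A ->
      P (X @^-1` A) = if s == 0 then \d_(0 : R) A else normal_prob 0 s A.

Definition isonormal (H : realHilbertType R) (W : H -> {RV P >-> R}) : Prop :=
  (forall n (c : 'I_n -> R) (h : 'I_n -> H),
     centred_gaussian (fun w => \sum_(i < n) c i * W (h i) w)) /\
  (forall g h : H, 'E_P[(fun w => W g w * W h w)%R]%E = (hdot g h)%:E).

Definition L2norm (X : Omega -> R) : \bar R := 'N[P]_2%:E[EFin \o X]%E.

(* The closed span in L^2 of the variables H_2(W(h)) with |h| = 1, where
   H_2(x) = x^2 - 1 is the second Hermite polynomial. *)
Definition second_chaos (H : realHilbertType R) (W : H -> {RV P >-> R}) :
    set {RV P >-> R} :=
  [set Y | (L2norm Y < +oo)%E /\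
    forall eps : R, 0 < eps ->
      exists n (c : 'I_n -> R) (h : 'I_n -> H),
        (forall i, `|h i| = 1) /\
        (L2norm (fun w => Y w - \sum_(i < n) c i * (W (h i) w ^+ 2 - 1))%R <
           eps%:E)%E].

(* Elements of L^2 are given by representatives, so the identities between
   them hold almost surely. Only the values of [I2] on symmetric tensors
   are constrained. *)
Definition is_second_wiener_isometry (H T : realHilbertType R)
    (tens : H -> H -> T) (W : H -> {RV P >-> R}) (I2 : T -> {RV P >-> R}) :
    Prop :=
  [/\ (forall (a : R) f g,
         symmetric_tensor tens f -> symmetric_tensor tens g ->
         {ae P, forall w, I2 (a *: f + g) w = a * I2 f w + I2 g w}),
      (forall f, symmetric_tensor tens f -> L2norm (I2 f) = (sym_norm f)%:E),
      (forall f, symmetric_tensor tens f -> second_chaos W (I2 f)),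
      (forall Y, second_chaos W Y ->
         exists2 f, symmetric_tensor tens f &
           {ae P, forall w, I2 f w = Y w}) &
      (forall h : H,
         {ae P, forall w, I2 (tens h h) w = W h w ^+ 2 - `|h| ^+ 2})].

End wiener_chaos.

Section moment_generating_function.
Context {R : realType}.

Definition cexp (z : R[i]) : R[i] :=
  (expR (complex.Re z))%:C *
    (cos (complex.Im z) +i* sin (complex.Im z)).

Definition polydisc (n : nat) (r : 'I_n -> \bar R) : set ('I_n -> R[i]) :=
  [set theta | forall k, ((ComplexField.Normc.normc (theta k))%:E < r k)%E].

Context {d : measure_display} {Omega : measurableType d}.
Variable P : probability Omega R.

Definition cexpectation (Z : Omega -> R[i]) : R[i] :=
  fine 'E_P[fun w => complex.Re (Z w)]%E +i*
  fine 'E_P[fun w => complex.Im (Z w)]%E.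

Definition mgf (n : nat) (X : 'I_n -> {RV P >-> R}) (theta : 'I_n -> R[i]) :
    R[i] :=
  cexpectation (fun w => cexp (\sum_(k < n) theta k * (X k w)%:C)).

Definition mgf_defined_on_polydisc (n : nat) (X : 'I_n -> {RV P >-> R})
    (r : 'I_n -> \bar R) : Prop :=
  forall q : 'I_n -> R, (forall k, 0 <= q k /\ ((q k)%:E < r k)%E) ->
    ('E_P[(fun w => expR (\sum_(k < n) q k * `|X k w|))%R] < +oo)%E.

End moment_generating_function.

(* Main.v *)
Require Import Defs.
From mathcomp Require Import all_boot all_order all_algebra.
From mathcomp Require Import all_classical all_reals all_analysis.
From mathcomp Require Import complex measurable_realfun ring lra.
Import Order.TTheory GRing.Theory Num.Theory.
Import numFieldNormedType.Exports.
Local Open Scope classical_set_scope.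
Local Open Scope ring_scope.
Set Implicit Arguments.
Unset Strict Implicit.
Unset Printing Implicit Defensive.

(** Write [Z = \sum_k theta_k X_k] and [s = \sum_k |theta_k| t_k], where [t_k]
    is slightly larger than [Num.sqrt 2] times the L^2 norm of [X_k], which is
    the tensor norm appearing in the hypothesis; the hypothesis lets one keep
    [s < 1]. The claims are that [exp (\sum_k |theta_k| |X_k|)] is integrable
    and that the expectation of [exp Z] is not zero.

    The second chaos is the L^2-closure of the finite sums
    [Y = \sum_i g_i (W (h_i) ^+ 2 - 1)] with unit vectors [h_i]. For such a
    [Y], complex coefficients [g_i] being allowed, let [A] be the tensor
    [\sum_i g_i h_i (x) h_i], and let [u_p] be the expectation of
    [Y ^+ p / p!]. Gaussian integration by parts ([isserlis],
    [stein_quadratic_form]) applied to the expectations of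
    [W (h_i) W (h_j) Y ^+ p] gives [u_0 = 1] and
    [(p + 1) u_(p+1) = \sum_(j <= p) c_j u_(p-j)], with [c_0 = 0] and
    [c_j = 2 ^ j tr (A ^ (j+1))] otherwise: the generating series of [u] is the
    formal solution of [phi' = c phi], which is what the formula
    [det_2 (1 - 2 z A) ^ (-1/2)] says after a logarithmic derivative. Since
    [|tr (A ^ (j+1))|] is at most the [j+1]-st power of the Hilbert-Schmidt norm
    of [A] ([gram_trace_le]), and since twice that norm is [Num.sqrt 2] times
    the L^2 norm of [Y] ([quadratic_form_norm2]), one has
    [|c_j| <= s ^ (j+1)] as soon as [2 * E |Y| ^ 2 <= s ^ 2]
    ([quadratic_form_recursion]). This has two consequences.

    Upper bound: by induction [|u_p| <= s ^ p] ([recursion_le]). For real [Y]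
    these moment bounds pass to L^2 limits ([chaos_closure_moment]) and sum up
    to exponential moments ([chaos_closure_exp]); a convexity argument treats
    several variables at once ([family_exp]). So the moment-generating function
    is defined.

    Lower bound: the solution [v] attached to [- c] obeys the same bounds, and
    the product of the two series is 1. Truncating at order [N] therefore gives
    [|\sum_(p <= N) u_p| >= (1 - s) (1 - eps_N)] with [eps_N] tending to 0 and
    depending on [s] and [N] only ([recursion_partial_sum_ge]). For fixed [N]
    this inequality passes to L^2 limits, because the moments converge
    ([moment_approximation]); then [N] goes to infinity by dominated
    convergence, the dominating function being provided by the upper bound
    ([cexpect_cexp_neq0]). *)

(** * Functions with moments of all orders *)

Section moments.
Context {R : realType} {d : measure_display} {T : measurableType d}.
Context (P : probability T R).
Local Notation intg F := (P.-integrable [set: T] (EFin \o F)).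
Local Notation E F := (Rintegral P [set: T] F).
Implicit Types F G : T -> R.

Lemma integrable_le_norm F G : measurable_fun setT F -> (forall w, `|F w| <= G w) ->
  intg G -> intg F.
Proof.
move=> mF FG; apply: le_integrable => //; first exact/measurable_EFinP.
by move=> w _ /=; rewrite lee_fin (le_trans (FG w))// ler_norm.
Qed.

Lemma integrable_const_fun (c : R) : intg (fun=> c).
Proof. by apply: (@finite_measure_integrable_cst _ _ _ P). Qed.

Lemma integrable_addr F G : intg F -> intg G -> intg (fun w => F w + G w).
Proof. by move=> iF iG; exact: (integrableD measurableT iF iG). Qed.

Lemma integrable_scaler (c : R) F : intg F -> intg (fun w => c * F w).
Proof. by move=> iF; exact: (integrableZl measurableT c iF). Qed.

Lemma integrable_normr F : intg F -> intg (fun w => `|F w|).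
Proof. exact: integrable_norm. Qed.

Lemma integrable_sqr_add F G : measurable_fun setT F -> measurable_fun setT G ->
  intg (fun w => F w ^+ 2) -> intg (fun w => G w ^+ 2) ->
  intg (fun w => (F w + G w) ^+ 2).
Proof.
move=> mF mG iF iG.
apply: (@integrable_le_norm _ (fun w => 2 * (F w ^+ 2 + G w ^+ 2))).
- by apply: measurable_funX; exact: measurable_funD.
- move=> w; rewrite ger0_norm ?sqr_ge0//.
  rewrite -subr_ge0 (_ : _ - _ = (F w - G w) ^+ 2) ?sqr_ge0//; ring.
- by apply: integrable_scaler; exact: integrable_addr.
Qed.

Lemma integrable_sumr (I : Type) (r : seq I) (F : I -> T -> R) :
  (forall i, intg (F i)) -> intg (fun w => \sum_(i <- r) F i w).
Proof.
move=> iF; elim: r => [|i r IH].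
  by under [X in EFin \o X]eq_fun do rewrite big_nil; exact: integrable_const_fun.
by under [X in EFin \o X]eq_fun do rewrite big_cons; exact: integrable_addr.
Qed.

Lemma expect_cst (c : R) : E (fun=> c) = c.
Proof. by rewrite Rintegral_cst// /fine /= probability_setT mulr1. Qed.

Lemma expectD F G : intg F -> intg G -> E (fun w => F w + G w) = E F + E G.
Proof. exact: RintegralD. Qed.

Lemma expectZ (c : R) F : intg F -> E (fun w => c * F w) = c * E F.
Proof. exact: RintegralZl. Qed.

Lemma expect_sum (I : Type) (r : seq I) (F : I -> T -> R) :
  (forall i, intg (F i)) ->
  E (fun w => \sum_(i <- r) F i w) = \sum_(i <- r) E (F i).
Proof.
move=> iF; elim: r => [|i r IH].
  by under [X in Rintegral _ _ X]eq_fun do rewrite big_nil; rewrite big_nil expect_cst.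
under [X in Rintegral _ _ X]eq_fun do rewrite big_cons.
by rewrite big_cons expectD ?IH//; exact: integrable_sumr.
Qed.

Lemma expect_le F G : intg F -> intg G -> (forall w, F w <= G w) -> E F <= E G.
Proof. by move=> iF iG FG; exact: le_Rintegral. Qed.

Lemma expect_ge0 F : (forall w, 0 <= F w) -> 0 <= E F.
Proof. by move=> F0; exact: Rintegral_ge0. Qed.

Lemma expect_fine F : intg F -> (\int[P]_w (F w)%:E = (E F)%:E)%E.
Proof. by move=> iF; rewrite /Rintegral fineK// integrable_fin_num. Qed.

Lemma integrable_of_integral_le F (B : \bar R) : measurable_fun setT F ->
  (forall w, 0 <= F w) -> (\int[P]_w (F w)%:E <= B)%E -> (B < +oo)%E -> intg F.
Proof.
move=> mF F0 FB Boo; apply/integrableP; split; first exact/measurable_EFinP.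
under eq_integral do rewrite /= ger0_norm//.
exact: le_lt_trans Boo.
Qed.

(** This class is closed under sums and products, so that polynomials in
    Gaussian variables are integrable without further estimates. *)
Definition all_moments F :=
  measurable_fun setT F /\ forall p : nat, intg (fun w => F w ^+ p).

Lemma moments_measurable F : all_moments F -> measurable_fun setT F.
Proof. by case. Qed.

Lemma moments_integrable F : all_moments F -> intg F.
Proof. by move=> [_ /(_ 1)]. Qed.

Lemma moments_integrable_normX F p : all_moments F -> intg (fun w => `|F w| ^+ p).
Proof.
move=> [_ /(_ p)/integrable_normr]; congr (P.-integrable _ _).
by apply/funext => w /=; rewrite normrX.
Qed.

Lemma moments_dominated F (G : nat -> T -> R) : measurable_fun setT F ->
  (forall p w, `|F w| ^+ p <= G p w) -> (forall p, intg (G p)) ->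
  all_moments F.
Proof.
move=> mF FG iG; split=> // p.
apply: integrable_le_norm (iG p); first exact: measurable_funX.
by move=> w; rewrite normrX.
Qed.

Lemma moments_cst c : all_moments (fun=> c).
Proof. by split=> // p; exact: integrable_const_fun. Qed.

Lemma moments_norm F : all_moments F -> all_moments (fun w => `|F w|).
Proof.
move=> aF; split; last by move=> p; exact: moments_integrable_normX.
exact/measurableT_comp/(moments_measurable aF).
Qed.

Lemma moments_add F G : all_moments F -> all_moments G ->
  all_moments (fun w => F w + G w).
Proof.
move=> aF aG.
apply: (@moments_dominated _ (fun p w => 2 ^+ p * (`|F w| ^+ p + `|G w| ^+ p))).
- by apply: measurable_funD; exact: moments_measurable.
- move=> p w; apply: (@le_trans _ _ ((`|F w| + `|G w|) ^+ p)).
    by rewrite lerXn2r ?nnegrE ?addr_ge0// ler_normD.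
  have [FG|/ltW GF] := leP `|F w| `|G w|.
    apply: (@le_trans _ _ ((2 * `|G w|) ^+ p)).
      by rewrite lerXn2r ?nnegrE ?addr_ge0 ?mulr_ge0//; lra.
    by rewrite exprMn ler_wpM2l ?exprn_ge0// lerDr exprn_ge0.
  apply: (@le_trans _ _ ((2 * `|F w|) ^+ p)).
    by rewrite lerXn2r ?nnegrE ?addr_ge0 ?mulr_ge0//; lra.
  by rewrite exprMn ler_wpM2l ?exprn_ge0// lerDl exprn_ge0.
- by move=> p; apply: integrable_scaler; apply: integrable_addr; exact: moments_integrable_normX.
Qed.

Lemma moments_mul F G : all_moments F -> all_moments G ->
  all_moments (fun w => F w * G w).
Proof.
move=> aF aG.
apply: (@moments_dominated _ (fun p w => `|F w| ^+ (p * 2) + `|G w| ^+ (p * 2))).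
- by apply: measurable_funM; exact: moments_measurable.
- move=> p w; rewrite normrM exprMn !exprM.
  have := sqr_ge0 (`|F w| ^+ p - `|G w| ^+ p).
  have : 0 <= `|F w| ^+ p * `|G w| ^+ p by rewrite mulr_ge0 ?exprn_ge0.
  rewrite sqrrB; nra.
- by move=> p; apply: integrable_addr; exact: moments_integrable_normX.
Qed.

Lemma moments_scale c F : all_moments F -> all_moments (fun w => c * F w).
Proof. by move=> aF; apply: moments_mul => //; exact: moments_cst. Qed.

Lemma moments_pow F p : all_moments F -> all_moments (fun w => F w ^+ p).
Proof.
move=> aF; elim: p => [|p IH]; first exact: moments_cst.
by under eq_fun do rewrite exprS; exact: moments_mul.
Qed.

Lemma moments_sum (I : Type) (r : seq I) (F : I -> T -> R) :
  (forall i, all_moments (F i)) -> all_moments (fun w => \sum_(i <- r) F i w).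
Proof.
move=> aF; elim: r => [|i r IH].
  by under eq_fun do rewrite big_nil; exact: moments_cst.
by under eq_fun do rewrite big_cons; exact: moments_add.
Qed.

End moments.

(** * Moments of a centred Gaussian variable *)

Section gaussian_mgf.
Context {R : realType}.
Local Notation mu := (@lebesgue_measure R).

Lemma fatou_bound {d : measure_display} {T : measurableType d}
    (P : {measure set T -> \bar R}) (F_ : nat -> T -> R) (F : T -> R) (B : R) :
  (forall n, measurable_fun setT (F_ n)) -> (forall n w, 0 <= F_ n w) ->
  (forall w, F_ n w @[n --> \oo] --> F w) ->
  (forall n, (\int[P]_w (F_ n w)%:E <= B%:E)%E) ->
  (\int[P]_w (F w)%:E <= B%:E)%E.
Proof.
move=> mF F0 cF FB.
have h : (\int[P]_w limn_einf (fun n => (F_ n w)%:E) <=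
    limn_einf (fun n => \int[P]_w (F_ n w)%:E))%E.
  apply: (@fatou _ _ _ P setT measurableT (fun n w => (F_ n w)%:E)) => //.
    by move=> n; exact/measurable_EFinP.
  by move=> n w _; rewrite lee_fin.
have <- : (\int[P]_w limn_einf (fun n => (F_ n w)%:E) =
    \int[P]_w (F w)%:E)%E.
  apply: eq_integral => w _; apply: (cvg_limn_einf_sup _).1.
  by apply: cvg_EFin; [exact: nearW | exact: cF].
apply: (le_trans h); rewrite limn_einf_lim; apply: lime_le; first exact: is_cvg_einfs.
apply: nearW => n; apply: ge_ereal_inf.
by exists (\int[P]_w (F_ n w)%:E)%E => //; exists n => /=.
Qed.

(** The Radon-Nikodym density of [normal_prob] and [normal_pdf] have the same
    integral over every measurable set, so they agree almost everywhere. *)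
Lemma ge0_integral_normal_prob (m s : R) (f : R -> \bar R) :
  (forall x, (0 <= f x)%E) -> measurable_fun setT f ->
  (\int[normal_prob m s]_x f x = \int[mu]_x (f x * (normal_pdf m s x)%:E))%E.
Proof.
move=> f0 mf.
have dom := normal_prob_dominates m s.
rewrite -(Radon_Nikodym_SigmaFinite.change_of_variables dom)//.
have mp : measurable_fun setT (fun x => (normal_pdf m s x)%:E).
  by apply/measurable_EFinP; exact: measurable_normal_pdf.
have iR := Radon_Nikodym_SigmaFinite.f_integrable dom.
apply: ae_eq_integral => //.
- by apply: emeasurable_funM => //; exact: measurable_int iR.
- exact: emeasurable_funM.
- apply: ae_eqe_mul2l; apply: integral_ae_eq => // A _ mA.
  by rewrite -Radon_Nikodym_SigmaFinite.f_integral.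
Qed.

(** Completing the square: tilting the density by [expR (t * x)] translates its
    mean by [t * s ^+ 2]. *)
Lemma normal_pdf_shift (s t x : R) : s != 0 ->
  expR (t * x) * normal_pdf 0 s x =
  expR (t ^+ 2 * s ^+ 2 / 2) * normal_pdf (t * s ^+ 2) s x.
Proof.
move=> s0; rewrite /normal_pdf (negbTE s0) mulrCA [RHS]mulrCA; congr (_ * _).
rewrite /normal_fun -!expRD; congr expR.
by rewrite -[_ *+ 2]mulr_natr; field.
Qed.

Context {d : measure_display} {T : measurableType d} (P : probability T R).
Local Notation intg F := (P.-integrable [set: T] (EFin \o F)).
Local Notation E F := (Rintegral P [set: T] F).

(** By [normal_pdf_shift] only the total mass of the translated density has to
    be computed. The exponent is kept as [t ^+ 2 * v] since [v] alone
    enters the comparison of coefficients in [centred_gaussian_moments]. *)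
Lemma centred_gaussian_mgf (X : T -> R) : measurable_fun setT X ->
  centred_gaussian P X ->
  exists s : R, forall t, (\int[P]_w (expR (t * X w))%:E =
    (expR (t ^+ 2 * (s ^+ 2 / 2)))%:E)%E.
Proof.
move=> mX [s s_ge0 hs]; exists s => t.
have mf : measurable_fun [set: measurableTypeR R]
    (fun x : measurableTypeR R => (expR (t * x))%:E).
  by apply/measurable_EFinP; apply: measurableT_comp.
have -> : (\int[P]_w (expR (t * X w))%:E =
    \int[pushforward P (X : T -> measurableTypeR R)]_x (expR (t * x))%:E)%E.
  by rewrite ge0_integral_pushforward// => x _; rewrite lee_fin expR_ge0.
have [s0|s0] := eqVneq s 0.
  rewrite (eq_measure_integral \d_(0 : measurableTypeR R)); last first.
    by move=> A mA _; rewrite [LHS](hs A mA) s0 eqxx.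
  by rewrite integral_dirac// s0 mulr0 expr0n/= mul0r mulr0 expR0 diracT mul1e.
rewrite (eq_measure_integral (normal_prob 0 s)); last first.
  by move=> A mA _; rewrite [LHS](hs A mA) (negbTE s0).
rewrite ge0_integral_normal_prob//.
under eq_integral do rewrite -EFinM normal_pdf_shift// EFinM.
rewrite ge0_integralZl//.
- by rewrite integral_normal_pdf mule1 mulrA.
- by apply/measurable_EFinP; exact: measurable_normal_pdf.
- by move=> x _; rewrite lee_fin normal_pdf_ge0.
Qed.
End gaussian_mgf.

Section exponential_sums.
Context {R : realType}.
Implicit Types (x t M : R) (a : nat -> R).

Lemma exp_sum_cvg x :
  \sum_(k < n) x ^+ k / k`!%:R @[n --> \oo] --> expR x.
Proof.
have -> : (fun n => \sum_(k < n) x ^+ k / k`!%:R) = series (exp_coeff x).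
  by rewrite seriesEord.
exact: is_cvg_series_exp_coeff.
Qed.

Lemma exp_sum_le x n : 0 <= x -> \sum_(k < n) x ^+ k / k`!%:R <= expR x.
Proof.
move=> x0; have c := @exp_sum_cvg x; rewrite -(cvg_lim _ c)//.
apply: nondecreasing_cvgn_le; last by apply/cvg_ex; exists (expR x).
move=> m p mp /=; rewrite -!(big_mkord predT (fun k => x ^+ k / k`!%:R)).
rewrite (big_cat_nat (n := m) (p := p))//= lerDl sumr_ge0// => i _.
by rewrite divr_ge0// exprn_ge0.
Qed.

Lemma exp_term_le x n : 0 <= x -> x ^+ n <= n`!%:R * expR x.
Proof.
move=> x0; rewrite mulrC -ler_pdivrMr ?ltr0n ?fact_gt0//.
apply: le_trans (exp_sum_le n.+1 x0); rewrite big_ord_recr/= lerDr sumr_ge0//.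
by move=> i _; rewrite divr_ge0// exprn_ge0.
Qed.

Lemma expR_normr_le x : expR `|x| <= expR x + expR (- x).
Proof.
have := expR_ge0 x; have := expR_ge0 (- x).
by case: (ger0P x) => _; lra.
Qed.

Lemma normr_exp_sum_le x n :
  `|\sum_(k < n) x ^+ k / k`!%:R| <= expR x + expR (- x).
Proof.
apply: le_trans (expR_normr_le x); apply: le_trans (exp_sum_le n (normr_ge0 x)).
apply: le_trans (ler_norm_sum _ _ _) _; apply: ler_sum => i _.
by rewrite normrM normrX [`|_^-1|]ger0_norm ?invr_ge0.
Qed.

(** If [a k] is the first coefficient that can be non-zero, dividing the series
    by [t ^+ k] and letting [t] tend to 0 kills it. Convergence is asked along
    partial sums of even length because the expansion of [expR (t ^+ 2 * v)]
    is indexed by even powers. *)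
Lemma power_series_eq0 a M : (forall n, \sum_(k < n) `|a k| <= M) ->
  (forall t, 0 < t <= 1 -> \sum_(k < n * 2) a k * t ^+ k @[n --> \oo] --> 0) ->
  forall k, a k = 0.
Proof.
move=> aM a0; elim/ltn_ind => k IH.
have M0 : 0 <= M by have := aM 0; rewrite big_ord0.
have bound t n : 0 < t <= 1 -> (k < n)%N ->
    `|\sum_(i < n) a i * t ^+ i - a k * t ^+ k| <= t ^+ k.+1 * M.
  move=> /andP[t0 t1] kn.
  rewrite (bigD1 (Ordinal kn))//= addrC addrK.
  apply: (le_trans (ler_norm_sum _ _ _)).
  apply: (@le_trans _ _ (\sum_(i < n) t ^+ k.+1 * `|a i|)); last first.
    by rewrite -mulr_sumr ler_wpM2l// exprn_ge0// ltW.
  rewrite big_mkcond/=; apply: ler_sum => i _; case: ifPn => [/eqP ik|_]; last first.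
    by rewrite mulr_ge0// exprn_ge0// ltW.
  have [ltik|ltki|eik] := ltngtP i k.
  - by rewrite IH// mul0r normr0 mulr0.
  - rewrite normrM mulrC ler_wpM2r// normrX gtr0_norm//.
    by apply: ler_wiXn2l => //; exact: ltW.
  - by case: ik; apply: val_inj.
have key t : 0 < t <= 1 -> `|a k| <= t * M.
  move=> t01; have /andP[t0 t1] := t01.
  have : `|a k * t ^+ k| <= t ^+ k.+1 * M.
    have c1 : `|\sum_(i < n * 2) a i * t ^+ i - a k * t ^+ k| @[n --> \oo]
        --> `|0 - a k * t ^+ k|.
      by apply: cvg_norm; apply: cvgB; [exact: a0|exact: cvg_cst].
    have c2 : (t ^+ k.+1 * M) @[n --> \oo] --> t ^+ k.+1 * M by exact: cvg_cst.
    rewrite -normrN -sub0r; apply: (ler_cvg_to c1 c2).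
    exists k.+1 => // n /= kn; apply: bound => //.
    by rewrite (leq_trans kn)// leq_pmulr.
  rewrite normrM (gtr0_norm (exprn_gt0 _ t0)) exprS -mulrA mulrCA [leLHS]mulrC.
  by rewrite ler_pM2l// exprn_gt0.
apply/normr0_eq0/eqP; rewrite eq_le normr_ge0 andbT; apply/ler_addgt0Pr => e e0.
rewrite add0r; set t := Num.min 1 (e / (M + 1)).
have t01 : 0 < t <= 1.
  by rewrite /t lt_min ltr01/= divr_gt0//= ?ge_min ?lexx//; lra.
apply: (le_trans (key t t01)).
have te : t <= e / (M + 1) by rewrite /t ge_min lexx orbT.
apply: (@le_trans _ _ (e / (M + 1) * (M + 1))).
  by apply: ler_pM => //; [lra|lra].
by rewrite divfK// gt_eqF//; lra.
Qed.

End exponential_sums.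

Section gaussian_moments.
Context {R : realType} {d : measure_display} {T : measurableType d}.
Context (P : probability T R).
Local Notation intg F := (P.-integrable [set: T] (EFin \o F)).
Local Notation E F := (Rintegral P [set: T] F).

Lemma expect_dominated_cvg (F_ : nat -> T -> R) (F G : T -> R) :
  (forall n, measurable_fun setT (F_ n)) -> measurable_fun setT F ->
  (forall w, F_ n w @[n --> \oo] --> F w) ->
  (forall n w, `|F_ n w| <= G w) -> intg G ->
  E (F_ n) @[n --> \oo] --> E F.
Proof.
move=> mF_ mF cF FG iG.
have [|||||_ _ c] := @dominated_convergence _ _ _ P setT measurableT
  (fun n w => (F_ n w)%:E) (fun w => (F w)%:E) (fun w => (G w)%:E).
- by move=> n; exact/measurable_EFinP.
- exact/measurable_EFinP.
- by apply: aeW => w _; apply: cvg_EFin; [exact: nearW|exact: cF].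
- exact: iG.
- by apply: aeW => w n _; rewrite lee_fin.
apply: fine_cvg; rewrite fineK//.
apply: integrable_fin_num => //; apply: integrable_le_norm mF _ iG => w.
have c1 : `|F_ n w| @[n --> \oo] --> `|F w| by apply: cvg_norm; exact: cF.
have c2 : G w @[n --> \oo] --> G w by exact: cvg_cst.
by apply: (ler_cvg_to c1 c2); exact: nearW.
Qed.

Lemma exp_all_moments (X : T -> R) : measurable_fun setT X ->
  intg (fun w => expR (X w)) -> intg (fun w => expR (- X w)) -> all_moments P X.
Proof.
move=> mX i1 i2.
apply: (@moments_dominated _ _ _ _ _ (fun p w => p`!%:R * (expR (X w) + expR (- X w)))) => //.
  move=> p w; apply: (le_trans (exp_term_le p (normr_ge0 _))).
  by rewrite ler_wpM2l// expR_normr_le.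
by move=> p; apply: integrable_scaler; exact: integrable_addr.
Qed.

(** For even [n] this is the double factorial [(n - 1)!!], in the form in which it
    appears in the expansion of [expR (t ^+ 2 / 2)]. *)
Definition gaussian_moment (n : nat) : R :=
  if odd n then 0 else n`!%:R / (2 ^+ n./2 * (n./2)`!%:R).

(** The exponential generating function of the moments is the
    moment-generating function, known from [centred_gaussian_mgf]; the moments
    follow by comparing coefficients. *)
Lemma centred_gaussian_moments (X : T -> R) : measurable_fun setT X ->
  centred_gaussian P X ->
  all_moments P X /\
  forall n, E (fun w => X w ^+ n) =
            gaussian_moment n * E (fun w => X w ^+ 2) ^+ n./2.
Proof.
move=> mX /(centred_gaussian_mgf mX)[s hs].
have mexp t : measurable_fun setT (fun w => expR (t * X w)).
  by apply: measurableT_comp => //; exact: measurable_funM.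
have iexp t : intg (fun w => expR (t * X w)).
  apply: (@integrable_of_integral_le _ _ _ _ _ (expR (t ^+ 2 * (s ^+ 2 / 2)))%:E) => //.
  - by rewrite hs.
  - exact: ltry.
have Eexp t : E (fun w => expR (t * X w)) = expR (t ^+ 2 * (s ^+ 2 / 2)).
  by rewrite /Rintegral hs.
have aX : all_moments P X.
  apply: exp_all_moments => //.
    by have := iexp 1; under [X in EFin \o X]eq_fun do rewrite mul1r.
  by have := iexp (- 1); under [X in EFin \o X]eq_fun do rewrite mulN1r.
split => //.
set v := s ^+ 2 / 2 in hs iexp Eexp.
have v0 : 0 <= v by rewrite divr_ge0 ?sqr_ge0.
clearbody v => {s}.
(* [b] and [e] are the coefficients of the two expansions to be compared. *)
pose b n := E (fun w => X w ^+ n) / n`!%:R.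
pose e n := if odd n then 0 else v ^+ n./2 / (n./2)`!%:R.
have Eb t n : E (fun w => \sum_(k < n) (t * X w) ^+ k / k`!%:R) =
    \sum_(k < n) b k * t ^+ k.
  rewrite expect_sum; last first.
    move=> k; under [X in EFin \o X]eq_fun do rewrite mulrC.
    by apply: integrable_scaler; apply: (moments_scale t aX).2.
  apply: eq_bigr => k _; rewrite /b.
  under [X in Rintegral _ _ X]eq_fun do rewrite exprMn mulrAC.
  by rewrite expectZ; [rewrite mulrC mulrA mulrAC|exact: aX.2].
have be t : \sum_(k < n * 2) b k * t ^+ k @[n --> \oo] --> expR (t ^+ 2 * v).
  rewrite -Eexp; under eq_fun do rewrite -Eb.
  apply: (@expect_dominated_cvg _ _ (fun w => expR (t * X w) + expR (- t * X w))).
  - move=> n; apply: (@moments_measurable _ _ _ P); apply: moments_sum => k.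
    under eq_fun do rewrite mulrC; apply: moments_scale.
    exact/moments_pow/moments_scale.
  - exact: mexp.
  - move=> w; apply: (@cvg_comp _ _ _ (fun n => n * 2)%N
      (fun n => \sum_(k < n) (t * X w) ^+ k / k`!%:R)); last exact: exp_sum_cvg.
    exact: cvg_mulnr.
  - by move=> n w; rewrite mulNr; exact: normr_exp_sum_le.
  - by apply: integrable_addr.
have ee t : \sum_(k < n * 2) e k * t ^+ k @[n --> \oo] --> expR (t ^+ 2 * v).
  have -> : (fun n => \sum_(k < n * 2) e k * t ^+ k) =
      (fun n => \sum_(k < n) (t ^+ 2 * v) ^+ k / k`!%:R).
    apply/funext; elim=> [|n IH]; first by rewrite !big_ord0.
    rewrite mulSn !big_ord_recr/= IH /e oddM andbF/= oddM andbF/= mul0r addr0.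
    rewrite muln2 doubleK; congr (_ + _).
    by rewrite exprMn -exprM mul2n mulrAC [t ^+ _ * _]mulrC.
  exact: exp_sum_cvg.
have eq_be j : b j = e j.
  apply/eqP; rewrite -subr_eq0; apply/eqP.
  apply: (@power_series_eq0 _ (fun k => b k - e k)
    (E (fun w => expR (1 * X w) + expR (- 1 * X w)) + expR v)) => [n|t t01].
    apply: (@le_trans _ _ (\sum_(k < n) `|b k| + \sum_(k < n) e k)).
      rewrite -big_split/=; apply: ler_sum => i _.
      apply: (le_trans (ler_normB _ _)); rewrite lerD2l ger0_norm// /e.
      by case: ifP => // _; rewrite divr_ge0 ?exprn_ge0.
    apply: lerD.
      apply: (@le_trans _ _
        (E (fun w => \sum_(k < n) `|X w| ^+ k / k`!%:R))).
        rewrite expect_sum; last first.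
          move=> k; under [X in EFin \o X]eq_fun do rewrite mulrC.
          by apply: integrable_scaler; exact: moments_integrable_normX.
        apply: ler_sum => k _; rewrite /b normrM.
        rewrite [`|_^-1|]ger0_norm ?invr_ge0//.
        under [X in _ <= Rintegral _ _ X]eq_fun do rewrite mulrC.
        rewrite expectZ; last exact: moments_integrable_normX.
        rewrite mulrC ler_wpM2l ?invr_ge0//.
        apply: (le_trans (le_normr_Rintegral measurableT (aX.2 k))).
        by under [X in Rintegral _ _ X]eq_fun do rewrite normrX.
      apply: expect_le.
      - apply: integrable_sumr => k; under [X in EFin \o X]eq_fun do rewrite mulrC.
        by apply: integrable_scaler; exact: moments_integrable_normX.
      - exact: integrable_addr.
      - move=> w; rewrite mul1r mulN1r.
        exact: le_trans (exp_sum_le _ _) (expR_normr_le _).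
    apply: (@le_trans _ _ (\sum_(k < n * 2) e k)).
      rewrite -!(big_mkord predT e) 
        (big_cat_nat (n := n) (p := (n * 2)%N))//=; last by rewrite leq_pmulr.
      rewrite lerDl sumr_ge0// => i _; rewrite /e.
      by case: ifP => // _; rewrite divr_ge0 ?exprn_ge0.
    apply: le_trans (exp_sum_le n v0); rewrite le_eqVlt; apply/orP; left; apply/eqP.
    elim: n => [|n IH]; first by rewrite !big_ord0.
    rewrite mulSn !big_ord_recr/= IH /e oddM andbF/= oddM andbF/= addr0.
    by rewrite muln2 doubleK.
  have -> : (fun n => \sum_(k < n * 2) (b k - e k) * t ^+ k) =
      (fun n => \sum_(k < n * 2) b k * t ^+ k - \sum_(k < n * 2) e k * t ^+ k).
    by apply/funext => n; rewrite -sumrB; apply: eq_bigr => k _; rewrite mulrBl.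
  have := cvgB (be t) (ee t); rewrite subrr; exact.
have Em n : E (fun w => X w ^+ n) = gaussian_moment n * (v * 2) ^+ n./2.
  have := eq_be n; rewrite /b /e /gaussian_moment.
  have n0 : n`!%:R != 0 :> R by rewrite pnatr_eq0 -lt0n fact_gt0.
  have h0 : (n./2)`!%:R != 0 :> R by rewrite pnatr_eq0 -lt0n fact_gt0.
  move/(congr1 ( *%R^~ n`!%:R)); rewrite divfK// => ->.
  case: ifP => _; first by rewrite !mul0r.
  rewrite exprMn; field; rewrite h0 expf_neq0//.
have g2 : gaussian_moment 2 = 1.
  by rewrite /gaussian_moment/= !factS fact0 !muln1 !expr1 mulr1 divff.
by move=> n; rewrite [in RHS]Em g2 mul1r.
Qed.

End gaussian_moments.

(** * Wick's formula by polarization *)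

Section polarization.
Context {R : realType} {V : lmodType R} (G : V -> Prop) (Phi : seq V -> R).
Hypothesis GZD : forall c x y, G x -> G y -> G (c *: x + y).
Hypothesis Phi_perm : forall l1 l2, perm_eq l1 l2 -> Phi l1 = Phi l2.
Hypothesis Phi_lin : forall (c : R) x y l, G x -> G y ->
  {in l, forall z, G z} -> Phi ((c *: x + y) :: l) = c * Phi (x :: l) + Phi (y :: l).

Lemma horner_eq0 (p : {poly R}) : (forall x, p.[x] = 0) -> p = 0.
Proof.
move=> p0; apply: (@roots_geq_poly_eq0 _ _ [seq n%:R | n <- iota 0 (size p)]).
- by apply/allP => _ /mapP[n _ ->]; rewrite /root p0.
- rewrite map_inj_uniq ?iota_uniq// => m n /eqP.
  by rewrite eqr_nat => /eqP.
- by rewrite size_map size_iota.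
Qed.

(** Along a line, a symmetric multilinear form is a polynomial in the
    parameter. The first two coefficients are all that polarization and the
    diagonal case of integration by parts read off. *)
Lemma multilinear_poly x y k l : G x -> G y -> {in l, forall z, G z} ->
  exists2 p : {poly R}, (forall e, p.[e] = Phi (l ++ nseq k (e *: x + y))) &
    p`_0 = Phi (l ++ nseq k y) /\
    p`_1 = k%:R * Phi (x :: l ++ nseq k.-1 y).
Proof.
move=> Gx Gy; elim: k l => [|k IH] l Gl.
  exists (Phi (l ++ [::]))%:P => [e|]; first by rewrite hornerC.
  by rewrite !coefC/= mul0r.
have [p hp [p0 p1]] := IH (x :: l) (fun z =>
  ltac:(by rewrite inE => /predU1P[->//|]; exact: Gl)).
have [q hq [q0 q1]] := IH (y :: l) (fun z =>
  ltac:(by rewrite inE => /predU1P[->//|]; exact: Gl)).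
exists ('X * p + q).
  move=> e; rewrite hornerD hornerM hornerX hp hq -Phi_lin//.
    by apply: Phi_perm; rewrite /= perm_sym perm_catC/= perm_cons perm_catC.
  move=> z; rewrite mem_cat => /orP[|/nseqP[-> _]]; first exact: Gl.
  exact: GZD.
rewrite !coefD !coefXM/= q0 add0r p0 q1; split.
  by apply: Phi_perm; rewrite /= perm_sym perm_catC/= perm_cons perm_catC.
case: k IH {p hp p0 p1 q hq q0 q1} => [|k] _ /=; first by rewrite mul0r addr0 mul1r.
rewrite -[in RHS]natr1 mulrDl mul1r addrC; congr (_ * _ + _).
apply: Phi_perm; rewrite /= perm_cons -/(nseq k y).
by rewrite perm_sym perm_catC/= perm_cons perm_catC.
Qed.

(** Starting from the diagonal, one repeated entry at a time is replaced by a
    free one: the form vanishes along the line [e *: y + x], and the linear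
    coefficient of this zero polynomial is a multiple of the form at the new
    arguments. *)
Lemma polarization_eq0 x0 N : G x0 -> (forall x, G x -> Phi (nseq N x) = 0) ->
  forall l, size l = N -> {in l, forall z, G z} -> Phi l = 0.
Proof.
move=> Gx0 Phi0 l sl Gl.
(* [m] entries are already free, [k] are still equal to [x]. *)
suff H m l1 x k : (m + k = N)%N -> size l1 = m -> {in l1, forall z, G z} ->
    G x -> Phi (l1 ++ nseq k x) = 0.
  by have := H (size l) l x0 0; rewrite addn0 cats0; apply.
elim: m l1 x k => [|m IH] l1 x k mk sl1 Gl1 Gx.
  by rewrite (size0nil sl1) /= -(add0n k) mk; exact: Phi0.
case: l1 sl1 Gl1 => // y l1 [sl1] Gl1.
have Gy : G y by apply: Gl1; rewrite mem_head.
have Gl2 z : z \in l1 -> G z by move=> zl; apply: Gl1; rewrite inE zl orbT.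
have [p hp [_ p1]] := multilinear_poly k.+1 Gy Gx Gl2.
have p0 : p = 0.
  apply: horner_eq0 => e; rewrite hp; apply: IH => //.
    by rewrite addnS.
  exact: GZD.
move: p1; rewrite p0 coef0 /= => /esym/eqP; rewrite mulf_eq0 pnatr_eq0/=.
by move=> /eqP.
Qed.

End polarization.

Section isserlis.
Context {R : realType} {d : measure_display} {T : measurableType d}.
Context (P : probability T R).
Local Notation intg F := (P.-integrable [set: T] (EFin \o F)).
Local Notation E F := (Rintegral P [set: T] F).

Lemma fct_lincombE (c : R) (u v : T -> R) w : (c *: u + v) w = c * u w + v w.
Proof. by []. Qed.

Definition seq_product (l : seq (T -> R)) (w : T) : R := \prod_(x <- l) x w.

(** Derivative of [seq_product] in the Gaussian direction [b]: a Leibniz rule in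
    which the factor [x] is replaced by its covariance with [b]. *)
Fixpoint dseq_product (b : T -> R) (l : seq (T -> R)) (w : T) : R :=
  if l is x :: l' then
    E (fun w => b w * x w) * seq_product l' w + x w * dseq_product b l' w
  else 0.

Lemma seq_product_nil w : seq_product [::] w = 1. Proof. by rewrite /seq_product big_nil. Qed.

Lemma seq_product_cons x l w : seq_product (x :: l) w = x w * seq_product l w.
Proof. by rewrite /seq_product big_cons. Qed.

Lemma seq_product_cat l1 l2 w : seq_product (l1 ++ l2) w = seq_product l1 w * seq_product l2 w.
Proof. by rewrite /seq_product big_cat. Qed.

Lemma seq_product_nseq n x w : seq_product (nseq n x) w = x w ^+ n.
Proof.
elim: n => [|n IH]; first by rewrite seq_product_nil.
by rewrite /= seq_product_cons IH exprS.
Qed.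

Lemma dseq_product_cat b l1 l2 w :
  dseq_product b (l1 ++ l2) w =
  dseq_product b l1 w * seq_product l2 w + seq_product l1 w * dseq_product b l2 w.
Proof.
elim: l1 => [|x l1 IH] /=; first by rewrite seq_product_nil mul0r add0r mul1r.
by rewrite IH seq_product_cat seq_product_cons; ring.
Qed.

Lemma dseq_product_nseq b n x w :
  dseq_product b (nseq n x) w = n%:R * E (fun w => b w * x w) * x w ^+ n.-1.
Proof.
elim: n => [|n IH]; first by rewrite !mul0r.
rewrite /= IH seq_product_nseq; case: n {IH} => [|n] /=; first by rewrite !expr0; ring.
by rewrite exprS -[n.+2%:R]natr1; ring.
Qed.

Lemma seq_product_perm l1 l2 : perm_eq l1 l2 -> seq_product l1 = seq_product l2.
Proof.
by move=> l12; apply/funext => w; rewrite /seq_product (perm_big _ l12).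
Qed.

Lemma dseq_product_perm b l1 l2 : perm_eq l1 l2 -> dseq_product b l1 = dseq_product b l2.
Proof.
apply: catCA_perm_subst => s1 s2 s3; apply/funext => w.
by rewrite !dseq_product_cat !seq_product_cat; ring.
Qed.

Variable G : (T -> R) -> Prop.
Hypothesis GZD : forall (c : R) x y, G x -> G y -> G (c *: x + y).
Hypothesis G_meas : forall x, G x -> measurable_fun setT x.
Hypothesis G_gauss : forall x, G x -> centred_gaussian P x.

Lemma gaussian_all_moments x : G x -> all_moments P x.
Proof. by move=> Gx; have [] := centred_gaussian_moments (G_meas Gx) (G_gauss Gx). Qed.

Lemma seq_product_all_moments l : {in l, forall z, G z} -> all_moments P (seq_product l).
Proof.
elim: l => [|x l IH] Gl.
  by rewrite /seq_product; under eq_fun do rewrite big_nil; exact: moments_cst.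
rewrite /seq_product; under eq_fun do rewrite big_cons; apply: moments_mul.
  by apply/gaussian_all_moments/Gl; rewrite mem_head.
by apply: IH => z zl; apply: Gl; rewrite inE zl orbT.
Qed.

Lemma dseq_product_all_moments b l : {in l, forall z, G z} -> all_moments P (dseq_product b l).
Proof.
elim: l => [|x l IH] Gl; first exact: moments_cst.
have Gl' z : z \in l -> G z by move=> zl; apply: Gl; rewrite inE zl orbT.
apply: moments_add; first by apply: moments_scale; exact: seq_product_all_moments.
by apply: moments_mul; [apply/gaussian_all_moments/Gl; rewrite mem_head|exact: IH].
Qed.

Lemma coef1_exp (p : {poly R}) n : (p ^+ n)`_1 = n%:R * p`_0 ^+ n.-1 * p`_1.
Proof.
have c0 m : (p ^+ m)`_0 = p`_0 ^+ m.
  elim: m => [|m IH]; first by rewrite !expr0 coef1.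
  by rewrite !exprS coefM big_ord1 subn0 IH.
elim: n => [|n IH]; first by rewrite expr0 coef1 !mul0r.
rewrite exprS coefM big_ord_recr big_ord1/= subnn subn0 IH c0.
case: n {IH} => [|n] /=; first by rewrite !expr0; ring.
by rewrite exprS -[n.+2%:R]natr1; ring.
Qed.

Lemma gaussian_momentSS n :
  gaussian_moment n.+2 = n.+1%:R * gaussian_moment n :> R.
Proof.
rewrite /gaussian_moment/= negbK; case: ifP => on; first by rewrite mulr0.
have n2 : n = (n./2).*2 by rewrite -[LHS](odd_double_half n) on.
have h (m : nat) : m`!%:R != 0 :> R by rewrite pnatr_eq0 -lt0n fact_gt0.
rewrite !factS !natrM exprS.
have -> : n.+2%:R = 2 * (n./2).+1%:R :> R.
  by rewrite {1}n2 -natrM mul2n doubleS.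
by field; rewrite h expf_neq0//= !andbT nat1r pnatr_eq0.
Qed.

(** The variable [e *: b + x] is Gaussian for every real [e], so its moment of
    order [n.+1] is a known polynomial in [e]; the claim is the equality of the
    coefficients of [e]. *)
Lemma stein_power b x n : G b -> G x ->
  E (fun w => b w * x w ^+ n) =
  n%:R * E (fun w => b w * x w) * E (fun w => x w ^+ n.-1).
Proof.
move=> Gb Gx.
pose Phi l := E (seq_product l).
have Phi_perm l1 l2 : perm_eq l1 l2 -> Phi l1 = Phi l2.
  by rewrite /Phi => /seq_product_perm ->.
have Phi_lin (c : R) u v l : G u -> G v -> {in l, forall z, G z} ->
    Phi ((c *: u + v) :: l) = c * Phi (u :: l) + Phi (v :: l).
  move=> Gu Gv Gl; rewrite /Phi.
  have iu : intg (seq_product (u :: l)).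
    by apply/moments_integrable/seq_product_all_moments => z; rewrite inE => /predU1P[->|/Gl].
  have iv : intg (seq_product (v :: l)).
    by apply/moments_integrable/seq_product_all_moments => z; rewrite inE => /predU1P[->|/Gl].
  rewrite -expectZ// -expectD//; last exact: integrable_scaler.
  by congr Rintegral; apply/funext => w; rewrite !seq_product_cons mulrA -mulrDl.
have [|p hp [_]] := multilinear_poly GZD Phi_perm Phi_lin n.+1 Gb Gx (l := [::]).
  by [].
rewrite /= {1}/Phi => p1.
(* [q.[e]] is the variance of [e *: b + x]. *)
pose q : {poly R} := (E (fun w => x w ^+ 2))%:P +
  (2 * E (fun w => b w * x w)) *: 'X + E (fun w => b w ^+ 2) *: 'X^2.
have ab := gaussian_all_moments Gb; have ax := gaussian_all_moments Gx.
have qE e : q.[e] = E (fun w => (e *: b + x) w ^+ 2).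
  rewrite /q !hornerE /=.
  have -> : (fun w => (e *: b + x) w ^+ 2) =
     (fun w => x w ^+ 2 + ((2 * e) * (b w * x w) + e ^+ 2 * b w ^+ 2)).
    by apply/funext => w; rewrite fct_lincombE; ring.
  have i1 : intg (fun w => b w * x w) by apply: moments_integrable; exact: moments_mul.
  have i2 : intg (fun w => b w ^+ 2) by exact: ab.2.
  rewrite expectD; [|exact: ax.2|by apply: integrable_addr; exact: integrable_scaler].
  by rewrite expectD ?expectZ//; [ring|exact: integrable_scaler|exact: integrable_scaler].
have pE : p = gaussian_moment n.+1 *: q ^+ (n.+1)./2.
  apply/eqP; rewrite -subr_eq0; apply/eqP/horner_eq0 => e.
  have Ge := GZD e Gb Gx.
  rewrite hornerD hornerN hornerZ horner_exp hp qE /Phi/=.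
  have [_ <-] := centred_gaussian_moments (G_meas Ge) (G_gauss Ge).
  apply/eqP; rewrite subr_eq0; apply/eqP; congr Rintegral; apply/funext => w.
  by rewrite seq_product_cons seq_product_nseq exprS.
have -> : (fun w => b w * x w ^+ n) = seq_product (b :: nseq n x).
  by apply/funext => w; rewrite seq_product_cons seq_product_nseq.
have [_ Em] := centred_gaussian_moments (G_meas Gx) (G_gauss Gx).
apply: (mulfI (_ : n.+1%:R != 0)); first by rewrite pnatr_eq0.
rewrite -p1 pE coefZ coef1_exp.
have -> : q`_0 = E (fun w => x w ^+ 2).
  by rewrite /q !coefD !coefZ coefC coefX coefXn/= !mulr0 !addr0.
have -> : q`_1 = 2 * E (fun w => b w * x w).
  by rewrite /q !coefD !coefZ coefC coefX coefXn/= !mulr0 mulr1 add0r addr0.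
case: n {p hp p1 pE} => [|n] /=.
  by rewrite !(mul0r, mulr0).
rewrite (Em n) gaussian_momentSS.
have [on|en] := boolP (odd n); first by rewrite /gaussian_moment on !(mul0r,mulr0).
have -> : n.+2%:R = 2 * (n./2).+1%:R :> R.
  rewrite -natrM mul2n doubleS; congr (_.+2%:R).
  by rewrite -[LHS](odd_double_half n) (negbTE en).
ring.
Qed.

(** Gaussian integration by parts. Both sides are symmetric and multilinear in
    [l], so by polarization it suffices to take all entries of [l] equal, which
    is [stein_power]. *)
Lemma isserlis b l : G b -> {in l, forall z, G z} ->
  E (fun w => b w * seq_product l w) = E (dseq_product b l).
Proof.
move=> Gb Gl; apply/eqP; rewrite -subr_eq0; apply/eqP.
pose Phi l := E (fun w => b w * seq_product l w) - E (dseq_product b l).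
rewrite -/(Phi l); apply: (polarization_eq0 GZD _ _ Gb _ erefl Gl).
- by rewrite /Phi => l1 l2 l12; rewrite (seq_product_perm l12) (dseq_product_perm b l12).
- move=> c x y {Gl}l Gx Gy Gl; rewrite /Phi.
  have ab := gaussian_all_moments Gb.
  have ax := gaussian_all_moments Gx; have ay := gaussian_all_moments Gy.
  have al := seq_product_all_moments Gl.
  have Gxl : {in x :: l, forall z, G z} by move=> z; rewrite inE => /predU1P[->|/Gl].
  have Gyl : {in y :: l, forall z, G z} by move=> z; rewrite inE => /predU1P[->|/Gl].
  have -> : (fun w => b w * seq_product (c *: x + y :: l) w) =
      (fun w => c * (b w * seq_product (x :: l) w) + b w * seq_product (y :: l) w).
    by apply/funext => w; rewrite !seq_product_cons fct_lincombE; ring.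
  have bc : E (fun w => b w * (c *: x + y) w) =
      c * E (fun w => b w * x w) + E (fun w => b w * y w).
    rewrite -expectZ; last by apply: moments_integrable; exact: moments_mul.
    rewrite -expectD.
    + by congr Rintegral; apply/funext => w; rewrite fct_lincombE; ring.
    + by apply: integrable_scaler; apply: moments_integrable; exact: moments_mul.
    + by apply: moments_integrable; exact: moments_mul.
  have -> : dseq_product b (c *: x + y :: l) =
      (fun w => c * dseq_product b (x :: l) w + dseq_product b (y :: l) w).
    by apply/funext => w; rewrite /= bc fct_lincombE; ring.
  have ix : intg (fun w => b w * seq_product (x :: l) w).
    by apply: moments_integrable; apply: moments_mul => //; exact: seq_product_all_moments.
  have iy : intg (fun w => b w * seq_product (y :: l) w).
    by apply: moments_integrable; apply: moments_mul => //; exact: seq_product_all_moments.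
  have jx : intg (dseq_product b (x :: l)).
    by apply: moments_integrable; exact: dseq_product_all_moments.
  have jy : intg (dseq_product b (y :: l)).
    by apply: moments_integrable; exact: dseq_product_all_moments.
  rewrite (expectD (integrable_scaler c ix) iy) (expectD (integrable_scaler c jx) jy).
  by rewrite (expectZ c ix) (expectZ c jx); ring.
- move=> x Gx; rewrite /Phi.
  under [X in Rintegral _ _ X - _]eq_fun do rewrite seq_product_nseq.
  rewrite stein_power//.
  have -> : dseq_product b (nseq (size l) x) = (fun w => (size l)%:R *
      E (fun w => b w * x w) * x w ^+ (size l).-1).
    by apply/funext => w; rewrite dseq_product_nseq.
  by rewrite expectZ ?subrr//; exact: (gaussian_all_moments Gx).2.
Qed.

End isserlis.

(** * Complex numbers and the equation phi' = c phi for power series *)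

Section complex_modulus.
Context {R : realType}.
Local Notation C := R[i].
Local Notation normc := (@ComplexField.Normc.normc R).
Local Notation toC := (real_complex R).
Implicit Types z : C.

Lemma normc_ge0 z : 0 <= normc z.
Proof. by case: z => a b /=; exact: sqrtr_ge0. Qed.

Lemma normc_sum (I : Type) (r : seq I) (F : I -> R[i]) :
  normc (\sum_(i <- r) F i) <= \sum_(i <- r) normc (F i).
Proof.
elim: r => [|i r IH]; first by rewrite !big_nil ComplexField.Normc.normc0.
by rewrite !big_cons (le_trans (le_normcD _ _))// lerD2l.
Qed.

Lemma normcX z n : normc (z ^+ n) = normc z ^+ n.
Proof.
elim: n => [|n IH]; first by rewrite !expr0 ComplexField.Normc.normc1.
by rewrite !exprS ComplexField.Normc.normcM IH.
Qed.

Lemma normc_sqr z : normc z ^+ 2 = complex.Re z ^+ 2 + complex.Im z ^+ 2.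
Proof. by case: z => a b /=; rewrite sqr_sqrtr// addr_ge0 ?sqr_ge0. Qed.

Lemma normc_real (x : R) : normc x%:C%C = `|x|.
Proof. by rewrite /= expr0n/= addr0 sqrtr_sqr. Qed.

Lemma normc_natr n : normc n%:R = n%:R.
Proof.
by rewrite -(rmorph_nat (real_complex R)) normc_real ger0_norm.
Qed.

Lemma normr_Re_le z : `|complex.Re z| <= normc z.
Proof.
by rewrite -ler_sqr ?nnegrE ?normc_ge0// normc_sqr real_normK ?num_real// lerDl sqr_ge0.
Qed.

Lemma normr_Im_le z : `|complex.Im z| <= normc z.
Proof.
by rewrite -ler_sqr ?nnegrE ?normc_ge0// normc_sqr real_normK ?num_real// lerDr sqr_ge0.
Qed.

Lemma normc_le_ReIm z : normc z <= `|complex.Re z| + `|complex.Im z|.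
Proof.
rewrite -ler_sqr ?nnegrE ?normc_ge0 ?addr_ge0// normc_sqr.
have := mulr_ge0 (normr_ge0 (complex.Re z)) (normr_ge0 (complex.Im z)).
by rewrite sqrrD !real_normK ?num_real// -mulr_natl; lra.
Qed.

Lemma Re_sum (I : Type) (r : seq I) (F : I -> C) :
  complex.Re (\sum_(i <- r) F i) = \sum_(i <- r) complex.Re (F i).
Proof.
elim: r => [|i r IH]; first by rewrite !big_nil.
by rewrite !big_cons -IH; case: (F i) (\sum_(j <- r) F j) => [a b] [x y].
Qed.

Lemma Im_sum (I : Type) (r : seq I) (F : I -> C) :
  complex.Im (\sum_(i <- r) F i) = \sum_(i <- r) complex.Im (F i).
Proof.
elim: r => [|i r IH]; first by rewrite !big_nil.
by rewrite !big_cons -IH; case: (F i) (\sum_(j <- r) F j) => [a b] [x y].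
Qed.

Lemma Re_mul_real z (x : R) : complex.Re (z * toC x) = complex.Re z * x.
Proof. by case: z => a b /=; rewrite mulr0 subr0. Qed.

Lemma Im_mul_real z (x : R) : complex.Im (z * toC x) = complex.Im z * x.
Proof. by case: z => a b /=; rewrite mulr0 add0r. Qed.

Lemma ReM z1 z2 : complex.Re (z1 * z2) =
  complex.Re z1 * complex.Re z2 - complex.Im z1 * complex.Im z2.
Proof. by case: z1 z2 => ? ? []. Qed.

Lemma ImM z1 z2 : complex.Im (z1 * z2) =
  complex.Re z1 * complex.Im z2 + complex.Im z1 * complex.Re z2.
Proof. by case: z1 z2 => ? ? []. Qed.

End complex_modulus.

Section exponential_recursion.
Context {R : realType}.
Local Notation C := R[i].
Local Notation normc := (@ComplexField.Normc.normc R).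

(** The coefficientwise form of [phi 0 = 1] and [phi' = c phi] for the
    generating series of [c] and [u]. *)
Definition log_derivative_recursion (c u : nat -> C) :=
  u 0 = 1 /\
  forall p, p.+1%:R * u p.+1 = \sum_(j < p.+1) c j * u (p - j)%N.

(** Course-of-values recursion; the most recent value comes first, so that the
    [j]-th entry is the one paired with [c j]. *)
Fixpoint recursion_values (c : nat -> C) (n : nat) : seq C :=
  if n is m.+1 then
    let l := recursion_values c m in
    (m.+1%:R^-1 * \sum_(j < m.+1) c j * l`_j) :: l
  else [:: 1].

Lemma recursion_exists c : exists u, log_derivative_recursion c u.
Proof.
exists (fun n => (recursion_values c n)`_0); split=> // p.
have vE n j : (j <= n)%N -> (recursion_values c n)`_j = (recursion_values c (n - j))`_0.
  elim: n j => [|n IH] [|j]//= jn; first by rewrite -IH.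
rewrite /= mulrA divff ?mul1r ?pnatr_eq0//.
by apply: eq_bigr => j _; rewrite vE// -ltnS.
Qed.

Lemma recursion_le (c u : nat -> C) (s : R) : 0 <= s ->
  log_derivative_recursion c u ->
  (forall j, normc (c j) <= s ^+ j.+1) -> forall n, normc (u n) <= s ^+ n.
Proof.
move=> s0 [u0 uS] cs; elim/ltn_ind => -[|p] IH.
  by rewrite u0 ComplexField.Normc.normc1.
rewrite -(ler_pM2l (_ : 0 < p.+1%:R))// -{1}normc_natr -ComplexField.Normc.normcM uS.
apply: (le_trans (normc_sum _ _)).
apply: (@le_trans _ _ (\sum_(j < p.+1) s ^+ p.+1)); last first.
  by rewrite sumr_const card_ord mulr_natl.
apply: ler_sum => j _; rewrite ComplexField.Normc.normcM.
have jp : (j <= p)%N by rewrite -ltnS.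
have -> : s ^+ p.+1 = s ^+ j.+1 * s ^+ (p - j) by rewrite -exprD addSn subnKC.
by rewrite ler_pM ?normc_ge0//; apply: IH; rewrite ltnS leq_subr.
Qed.

(** If [phi' = c phi] and [psi' = - c psi] then [(phi psi)' = 0]. Working with
    truncations at degree [N] keeps everything in the polynomial ring, and only
    the coefficients of degree at most [N] are then meaningful. *)
Lemma recursion_opp_inverse (c u v : nat -> C) N :
  log_derivative_recursion c u ->
  log_derivative_recursion (fun j => - c j) v ->
  forall n, (n <= N)%N ->
    ((\poly_(i < N.+1) u i) * (\poly_(i < N.+1) v i))`_n = (n == 0)%:R.
Proof.
move=> [u0 uS] [v0 vS]; set U := \poly_(i < _) u i; set V := \poly_(i < _) v i.
set K := \poly_(i < N.+1) c i.
have UE i : (i <= N)%N -> U`_i = u i by move=> iN; rewrite coef_poly ltnS iN.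
have VE i : (i <= N)%N -> V`_i = v i by move=> iN; rewrite coef_poly ltnS iN.
have KE i : (i <= N)%N -> K`_i = c i by move=> iN; rewrite coef_poly ltnS iN.
have dU j : (j < N)%N -> U^`()`_j = (K * U)`_j.
  move=> jN; rewrite coef_deriv UE// -mulr_natl uS coefM; apply: eq_bigr => i _.
  rewrite KE ?UE//; last by rewrite -ltnS (leq_trans (ltn_ord i))// ltnW.
  by rewrite (leq_trans (leq_subr _ _))// ltnW.
have dV j : (j < N)%N -> V^`()`_j = - (K * V)`_j.
  move=> jN; rewrite coef_deriv VE// -mulr_natl vS coefM -sumrN.
  apply: eq_bigr => i _.
  rewrite KE ?VE ?mulNr//; last by rewrite -ltnS (leq_trans (ltn_ord i))// ltnW.
  by rewrite (leq_trans (leq_subr _ _))// ltnW.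
case=> [|n] nN; first by rewrite coefM big_ord1 subnn UE// VE// u0 v0 mulr1.
have : (U * V)^`()`_n = 0.
  rewrite derivM coefD !coefM.
  have -> : \sum_(j < n.+1) U^`()`_j * V`_(n - j) = (K * U * V)`_n.
    by rewrite coefM; apply: eq_bigr => j _; rewrite dU// (leq_trans _ nN).
  have -> : \sum_(j < n.+1) U`_j * V^`()`_(n - j) = - (U * (K * V))`_n.
    rewrite coefM -sumrN; apply: eq_bigr => j _; rewrite dV ?mulrN//.
    by rewrite (leq_trans _ nN)// ltnS leq_subr.
  by rewrite mulrA [U * K]mulrC subrr.
by rewrite coef_deriv => /eqP; rewrite mulrn_eq0/= => /eqP.
Qed.

Lemma geometric_sum_le (t : R) n : 0 <= t < 1 ->
  \sum_(i < n) t ^+ i <= (1 - t)^-1.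
Proof.
move=> /andP[t0 t1]; have t1' : 0 < 1 - t by rewrite subr_gt0.
rewrite -(ler_pM2l t1') divff ?gt_eqF// -opprB mulNr -subrX1 opprB.
by rewrite gerBl exprn_ge0.
Qed.

Lemma geometric_sum_shift (t : R) m n : 0 <= t < 1 ->
  \sum_(m <= i < n) t ^+ i <= t ^+ m / (1 - t).
Proof.
move=> t01; have /andP[t0 _] := t01.
have [mn|nm] := leqP m n; last first.
  rewrite big_geq 1?ltnW// divr_ge0 ?exprn_ge0//.
  by rewrite subr_ge0 ltW//; case/andP: t01.
rewrite -{1}[m]add0n -{1}(subnK mn) big_addn addnK big_mkord.
under eq_bigr do rewrite exprD mulrC.
by rewrite -mulr_sumr ler_wpM2l ?exprn_ge0// geometric_sum_le.
Qed.

Lemma natr_geometric_le (t : R) n : 0 <= t < 1 -> n.+1%:R * t ^+ n <= (1 - t)^-1.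
Proof.
move=> t01; have /andP[t0 t1] := t01.
apply: le_trans (geometric_sum_le n.+1 t01).
rewrite mulr_natl -[X in _ *+ X](card_ord n.+1) -sumr_const.
by apply: ler_sum => i _; apply: ler_wiXn2l; rewrite ?(ltW t1)//; exact: ltn_ord i.
Qed.

(** Let [U] and [V] be the truncations at degree [N] of the solutions for [c]
    and [- c]. By [recursion_opp_inverse], [U * V] is 1 plus terms of degree
    larger than [N]; at the point 1 these are small, while [V.[1]] is bounded by
    a geometric series, which bounds [U.[1]] from below. A coefficient of [U * V]
    has up to [n.+1] terms of size [s ^+ n]; writing [s] as a square [t ^+ 2]
    leaves a factor [t ^+ n] to absorb [n.+1]. *)
Lemma recursion_partial_sum_ge (c u : nat -> C) (t : R) N : 0 <= t < 1 ->
  log_derivative_recursion c u ->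
  (forall j, normc (c j) <= (t ^+ 2) ^+ j.+1) ->
  (1 - t ^+ 2) * (1 - t ^+ N.+1 / (1 - t) ^+ 2) <=
    normc (\sum_(n < N.+1) u n).
Proof.
move=> t01 hu cs; have /andP[t0 t1] := t01.
have [v hv] := recursion_exists (fun j => - c j).
have s0 : 0 <= t ^+ 2 by exact: exprn_ge0.
have s1 : t ^+ 2 < 1 by rewrite expr_lt1.
have ule := recursion_le s0 hu cs.
have vle : forall n, normc (v n) <= (t ^+ 2) ^+ n.
  by apply: (recursion_le s0 hv) => j; rewrite normcN.
set U := \poly_(i < N.+1) u i; set V := \poly_(i < N.+1) v i.
have UVE := recursion_opp_inverse (N := N) hu hv.
have U1 : U.[1] = \sum_(n < N.+1) u n.
  by rewrite horner_poly; apply: eq_bigr => i _; rewrite expr1n mulr1.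
have V1 : normc V.[1] <= (1 - t ^+ 2)^-1.
  rewrite horner_poly; apply: (le_trans (normc_sum _ _)).
  apply: le_trans (geometric_sum_le N.+1 (_ : 0 <= t ^+ 2 < 1)); last by rewrite s0.
  by apply: ler_sum => i _; rewrite expr1n mulr1.
have coefle n : normc (U * V)`_n <= t ^+ n / (1 - t).
  rewrite coefM; apply: (le_trans (normc_sum _ _)).
  apply: (@le_trans _ _ (\sum_(j < n.+1) (t ^+ 2) ^+ n)).
    apply: ler_sum => j _; rewrite ComplexField.Normc.normcM !coef_poly.
    have jn : (j <= n)%N by rewrite -ltnS.
    have -> : (t ^+ 2) ^+ n = (t ^+ 2) ^+ j * (t ^+ 2) ^+ (n - j).
      by rewrite -exprD subnKC.
    rewrite ler_pM ?normc_ge0//; case: ifP => // _;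
      by rewrite ComplexField.Normc.normc0 exprn_ge0.
  rewrite sumr_const card_ord -mulr_natl -exprM mul2n -addnn exprD mulrA mulrC.
  by rewrite ler_wpM2l ?exprn_ge0// natr_geometric_le.
have UV1 : normc (U.[1] * V.[1] - 1) <= t ^+ N.+1 / (1 - t) ^+ 2.
  rewrite -hornerM (@horner_coef_wide _ (N.+1 + N.+1)); last first.
    apply: (leq_trans (size_polyMleq _ _)).
    by rewrite (leq_trans (leq_pred _))// leq_add// size_poly.
  rewrite -(big_mkord predT (fun i => (U * V)`_i * 1 ^+ i)).
  rewrite (big_cat_nat (n := N.+1))//=; last by rewrite leq_addr.
  rewrite big_nat_recl// big_nat big1 => [|i /andP[_ iN]]; last first.
    by rewrite UVE// mul0r.
  rewrite UVE// mul1r expr0 addr0 addrC addrK.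
  apply: (le_trans (normc_sum _ _)).
  apply: (@le_trans _ _ (\sum_(N.+1 <= i < N.+1 + N.+1) t ^+ i * (1 - t)^-1)).
    by apply: ler_sum => i _; rewrite expr1n mulr1.
  rewrite -mulr_suml expr2 invfM mulrA; apply: ler_wpM2r.
    by rewrite invr_ge0 subr_ge0 ltW.
  exact: geometric_sum_shift.
rewrite -U1 mulrC -ler_pdivlMr ?subr_gt0//.
apply: (@le_trans _ _ (normc (U.[1] * V.[1]))); last first.
  by rewrite ComplexField.Normc.normcM ler_wpM2l ?normc_ge0.
have h : 1 <= normc (U.[1] * V.[1]) + normc (U.[1] * V.[1] - 1).
  rewrite -[X in X <= _](@ComplexField.Normc.normc1 R) -[X in normc X <= _](subKr (U.[1] * V.[1])).
  by rewrite (le_trans (le_normcD _ _))// normcN.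
by move: h UV1; lra.
Qed.

End exponential_recursion.

(** * Gram matrices and traces *)

Section gram.
Context {R : realType}.

Lemma cauchy_schwarz_sum (I : finType) (x y : I -> R) :
  (\sum_i x i * y i) ^+ 2 <= (\sum_i x i ^+ 2) * (\sum_i y i ^+ 2).
Proof.
have : 0 <= \sum_i \sum_j (x i * y j - x j * y i) ^+ 2.
  by apply: sumr_ge0 => i _; apply: sumr_ge0 => j _; exact: sqr_ge0.
have -> : \sum_i \sum_j (x i * y j - x j * y i) ^+ 2 =
  \sum_i \sum_j (x i ^+ 2 * y j ^+ 2) + \sum_i \sum_j (x j ^+ 2 * y i ^+ 2)
  - 2 * \sum_i \sum_j ((x i * y i) * (x j * y j)).
  rewrite mulr_sumr -sumrN -!big_split/=; apply: eq_bigr => i _.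
  by rewrite mulr_sumr -sumrN -!big_split/=; apply: eq_bigr => j _; ring.
rewrite [X in _ + X - _]exchange_big/=.
have -> : \sum_i \sum_j (x i ^+ 2 * y j ^+ 2) = (\sum_i x i ^+ 2) * (\sum_i y i ^+ 2).
  by rewrite mulr_suml; apply: eq_bigr => i _; rewrite mulr_sumr.
have -> : \sum_i \sum_j ((x i * y i) * (x j * y j)) = (\sum_i x i * y i) ^+ 2.
  by rewrite expr2 mulr_suml; apply: eq_bigr => i _; rewrite mulr_sumr.
lra.
Qed.

(** Gram-Schmidt: the vectors are made orthogonal to [h ord0], and the column of
    their components along it is put in front. When [h ord0 = 0] the convention
    [x / 0 = 0] makes this column zero, as it should be. *)
Lemma gram_factorization (H : realHilbertType R) n (h : 'I_n -> H) :
  exists L : 'M[R]_n, forall i j, hdot (h i) (h j) = \sum_k L i k * L j k.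
Proof.
have dotZDr (a : R) (x y z : H) : hdot z (a *: x + y) = a * hdot z x + hdot z y.
  by rewrite hdotC hdot_linearl ![hdot _ z]hdotC.
elim: n h => [|n IH] h; first by exists 0 => -[].
set v := h ord0; set q := `|v|.
have vv : hdot v v = q ^+ 2 by rewrite hdotxx.
pose a i := hdot (h i) v / q ^+ 2.
have [L hL] := IH (fun i => (- a (lift ord0 i)) *: v + h (lift ord0 i)).
pose M := \matrix_(i < n.+1, k < n.+1)
  if unlift ord0 k is Some k' then
    if unlift ord0 i is Some i' then L i' k' else 0
  else hdot (h i) v / q.
exists M => i j; rewrite big_ord_recl.
have M0 i1 : M i1 ord0 = hdot (h i1) v / q by rewrite mxE unlift_none.
rewrite !M0.
have q0v x : q = 0 -> hdot x v = 0.
  move=> /normr0_eq0 ->; have := dotZDr 0 v 0 x.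
  rewrite scale0r add0r mul0r add0r => ->.
  by have := dotZDr 1 0 0 x; rewrite scaler0 add0r mul1r; lra.
have aux x : hdot v x = hdot v v / q * (hdot x v / q).
  have [q0|q0] := eqVneq q 0; first by rewrite hdotC !q0v// mul0r mulr0.
  by rewrite vv [hdot v x]hdotC; field.
case: (unliftP ord0 i) => [i'|] ->; last first.
  rewrite big1 ?addr0 -?/v; first exact: aux.
  by move=> k _; rewrite !mxE unlift_none liftK mul0r.
case: (unliftP ord0 j) => [j'|] ->; last first.
  rewrite big1 ?addr0 -?/v; first by rewrite -/v [LHS]hdotC aux mulrC.
  by move=> k _; rewrite !mxE unlift_none liftK mulr0.
rewrite (eq_bigr (fun k => L i' k * L j' k)); last by move=> k _; rewrite !mxE !liftK.
rewrite -hL hdot_linearl !dotZDr vv /a.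
set x := hdot (h (lift _ i')) v; set y := hdot (h (lift _ j')) v.
have -> : hdot v (h (lift ord0 j')) = y by rewrite hdotC.
have [q0|q0] := eqVneq q 0; last by field.
by rewrite q0 expr0n/= invr0; ring.
Qed.

Local Notation C := R[i].
Local Notation normc := (@ComplexField.Normc.normc R).
Local Notation toC := (real_complex R).

Definition frobenius_sqr m n (A : 'M[C]_(m, n)) : R :=
  \sum_i \sum_j normc (A i j) ^+ 2.

Lemma frobenius_sqr_ge0 m n (A : 'M[C]_(m, n)) : 0 <= frobenius_sqr A.
Proof. by apply: sumr_ge0 => i _; apply: sumr_ge0 => j _; exact: sqr_ge0. Qed.

Lemma normc_sum_mul_le (I : finType) (x y : I -> C) :
  normc (\sum_i x i * y i) ^+ 2 <=
  (\sum_i normc (x i) ^+ 2) * (\sum_i normc (y i) ^+ 2).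
Proof.
apply: le_trans (cauchy_schwarz_sum _ _).
rewrite ler_sqr ?nnegrE ?normc_ge0 ?sumr_ge0//; last first.
  by move=> i _; rewrite mulr_ge0// normc_ge0.
apply: (le_trans (normc_sum _ _)).
by apply: ler_sum => i _; rewrite ComplexField.Normc.normcM.
Qed.

Lemma frobenius_sqr_mul m n p (A : 'M[C]_(m, n)) (B : 'M[C]_(n, p)) :
  frobenius_sqr (A *m B) <= frobenius_sqr A * frobenius_sqr B.
Proof.
rewrite /frobenius_sqr [X in _ <= _ * X]exchange_big mulr_suml/=.
apply: ler_sum => i _; rewrite mulr_sumr; apply: ler_sum => k _.
by rewrite mxE; exact: normc_sum_mul_le.
Qed.

Lemma normc_trace_mul_le n (A B : 'M[C]_n) :
  normc (\tr (A *m B)) ^+ 2 <= frobenius_sqr A * frobenius_sqr B.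
Proof.
rewrite /mxtrace; under eq_bigr do rewrite mxE.
rewrite pair_big/=; apply: (le_trans (normc_sum_mul_le _ _)).
rewrite /frobenius_sqr pair_big/= [X in _ <= _ * X]exchange_big/= pair_big/=.
by [].
Qed.

(** The Frobenius norm is submultiplicative and controls the trace of a product
    of two matrices; this needs at least two factors [A], whence the
    exponents. *)
Lemma trace_power_le n (A : 'M[C]_n) j :
  normc (\tr (A *m iter j.+1 (fun X => X *m A) 1%:M)) <=
  Num.sqrt (frobenius_sqr A) ^+ j.+2.
Proof.
have A0 := frobenius_sqr_ge0 A.
have pow k : frobenius_sqr (iter k.+1 (fun X => X *m A) 1%:M) <= frobenius_sqr A ^+ k.+1.
  elim: k => [|k IH]; first by rewrite /= mul1mx expr1.
  rewrite iterS exprSr (le_trans (frobenius_sqr_mul _ _))// ler_wpM2r//.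
rewrite -ler_sqr ?nnegrE ?normc_ge0 ?exprn_ge0 ?sqrtr_ge0//.
rewrite -exprM mulnC exprM sqr_sqrtr// exprS.
by rewrite (le_trans (normc_trace_mul_le _ _))// ler_wpM2l.
Qed.

Lemma weighted_gram_frobenius n (L : 'M[R]_n) (x : 'I_n -> R) :
  \sum_a \sum_b (\sum_i x i * (L i a * L i b)) ^+ 2 =
  \sum_i \sum_j x i * x j * (\sum_k L i k * L j k) ^+ 2.
Proof.
under eq_bigr => a _ do under eq_bigr => b _ do rewrite expr2 mulr_suml.
under eq_bigr => a _ do rewrite exchange_big.
rewrite exchange_big/=; apply: eq_bigr => i _.
under eq_bigr => a _ do under eq_bigr => b _ do rewrite mulr_sumr.
under eq_bigr => a _ do rewrite exchange_big.
rewrite exchange_big/=; apply: eq_bigr => j _.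
rewrite expr2 mulr_suml mulr_sumr; apply: eq_bigr => a _.
by rewrite !mulr_sumr; apply: eq_bigr => b _; ring.
Qed.

(** The matrix [G (D G) ^ j], [D] being the diagonal matrix of the weights. *)
Definition gram_powers n (g : 'I_n -> C) (G : 'M[C]_n) j : 'M[C]_n :=
  iter j (fun X => X *m diag_mx (\row_i g i) *m G) G.

(** With [K = L L^T], cyclicity of the trace turns [tr ((D K) ^ k)] into
    [tr (N ^ k)] for [N = L^T D L]. The matrix [N] represents the tensor
    [\sum_i g i h_i (x) h_i] in an orthonormal basis, hence its Frobenius norm is
    the Hilbert-Schmidt norm of the tensor; that of [D K] is not. *)
Lemma gram_trace_le n (g : 'I_n -> C) (L : 'M[R]_n) (K : 'I_n -> 'I_n -> R) j :
  (forall i k, K i k = \sum_l L i l * L k l) ->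
  normc (\tr (diag_mx (\row_i g i) *m
    gram_powers g (\matrix_(i, j) toC (K i j)) j.+1)) <=
  Num.sqrt (\sum_i \sum_j
    (complex.Re (g i) * complex.Re (g j) + complex.Im (g i) * complex.Im (g j))
    * K i j ^+ 2) ^+ j.+2.
Proof.
move=> KE; set D := diag_mx _; set G := \matrix_(i, j) _.
pose M := map_mx toC L; pose N := M^T *m D *m M.
have GE : G = M *m M^T.
  apply/matrixP => i k; rewrite !mxE KE rmorph_sum/=; apply: eq_bigr => l _.
  by rewrite !mxE rmorphM.
have powE k : gram_powers g G k = M *m iter k (fun X => X *m N) 1%:M *m M^T.
  elim: k => [|k IH]; first by rewrite /= mulmx1.
  by rewrite /gram_powers iterS -/(gram_powers g G k) IH /= {1}GE /N !mulmxA.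
have -> : D *m gram_powers g G j.+1 =
    (D *m M *m iter j.+1 (fun X => X *m N) 1%:M) *m M^T.
  by rewrite powE !mulmxA.
have := trace_power_le N j; move: (iter j.+1 _ _) => Y.
have -> : \tr (D *m M *m Y *m M^T) = \tr (N *m Y).
  by rewrite [LHS]mxtrace_mulC !mulmxA.
move=> NY; apply: (le_trans NY) => {NY Y}; rewrite le_eqVlt; apply/orP; left.
apply/eqP; congr (Num.sqrt _ ^+ _); rewrite /frobenius_sqr.
have NE a b : N a b = \sum_i g i * toC (L i a * L i b).
  rewrite /N /D mul_mx_diag mxE; apply: eq_bigr => i _.
  by rewrite !mxE rmorphM/=; ring.
under eq_bigr => a _ do under eq_bigr => b _ do
  (rewrite normc_sqr NE Re_sum Im_sum;
   under eq_bigr do rewrite Re_mul_real;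
   under [X in _ + X ^+ 2]eq_bigr do rewrite Im_mul_real).
under eq_bigr do rewrite big_split/=.
rewrite big_split/= !weighted_gram_frobenius -big_split/=.
apply: eq_bigr => i _; rewrite -big_split/=; apply: eq_bigr => k _.
by rewrite -mulrDl KE.
Qed.

End gram.

(** * Quadratic forms in Gaussian variables *)

Section complex_expectation.
Context {R : realType} {d : measure_display} {T : measurableType d}.
Context (P : probability T R).
Local Notation C := R[i].
Local Notation normc := (@ComplexField.Normc.normc R).
Local Notation E F := (Rintegral P [set: T] F).
Local Notation toC := (real_complex R).
Implicit Types Z Y : T -> C.

Definition complex_all_moments Z :=
  all_moments P (fun w => complex.Re (Z w)) /\
  all_moments P (fun w => complex.Im (Z w)).
Local Notation cam := complex_all_moments.

Definition cexpect Z : C :=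
  Complex (E (fun w => complex.Re (Z w))) (E (fun w => complex.Im (Z w))).
Local Notation cE := cexpect.

Lemma cmoments_ext Z Y : (forall w, Z w = Y w) -> cam Z -> cam Y.
Proof. by move=> ZY; have -> : Y = Z by apply/funext. Qed.

Lemma cmoments_real F : all_moments P F -> cam (fun w => toC (F w)).
Proof. by move=> aF; split=> //=; exact: moments_cst. Qed.

Lemma cmoments_cst (c : C) : cam (fun=> c).
Proof. by split; exact: moments_cst. Qed.

Lemma moments_sub F G : all_moments P F -> all_moments P G ->
  all_moments P (fun w => F w - G w).
Proof.
move=> aF aG; have := moments_add aF (moments_scale (-1) aG).
by congr all_moments; apply/funext => w; rewrite mulN1r.
Qed.

Lemma cmoments_add Z Y : cam Z -> cam Y -> cam (fun w => Z w + Y w).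
Proof.
move=> [Z1 Z2] [Y1 Y2]; split.
  have := moments_add Z1 Y1; congr all_moments; apply/funext => w.
  by case: (Z w) (Y w) => ? ? [].
have := moments_add Z2 Y2; congr all_moments; apply/funext => w.
by case: (Z w) (Y w) => ? ? [].
Qed.

Lemma cmoments_mul Z Y : cam Z -> cam Y -> cam (fun w => Z w * Y w).
Proof.
move=> [Z1 Z2] [Y1 Y2]; split.
  have := moments_sub (moments_mul Z1 Y1) (moments_mul Z2 Y2); congr all_moments.
  by apply/funext => w; case: (Z w) (Y w) => ? ? [].
have := moments_add (moments_mul Z1 Y2) (moments_mul Z2 Y1); congr all_moments.
by apply/funext => w; case: (Z w) (Y w) => ? ? [].
Qed.

Lemma cmoments_pow Z n : cam Z -> cam (fun w => Z w ^+ n).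
Proof.
move=> aZ; elim: n => [|n IH]; first exact: cmoments_cst.
by apply: cmoments_ext (cmoments_mul aZ IH) => w; rewrite exprS.
Qed.

Lemma cmoments_sum (I : Type) (r : seq I) (F : I -> T -> C) :
  (forall i, cam (F i)) -> cam (fun w => \sum_(i <- r) F i w).
Proof.
move=> aF; elim: r => [|i r IH].
  by apply: cmoments_ext (cmoments_cst 0) => w; rewrite big_nil.
by apply: cmoments_ext (cmoments_add (aF i) IH) => w; rewrite big_cons.
Qed.

Lemma cexpectD Z Y : cam Z -> cam Y -> cE (fun w => Z w + Y w) = cE Z + cE Y.
Proof.
move=> [Z1 Z2] [Y1 Y2]; rewrite /cexpect.
have -> : (fun w => complex.Re (Z w + Y w)) =
    (fun w => complex.Re (Z w) + complex.Re (Y w)).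
  by apply/funext => w; case: (Z w) (Y w) => ? ? [].
have -> : (fun w => complex.Im (Z w + Y w)) =
    (fun w => complex.Im (Z w) + complex.Im (Y w)).
  by apply/funext => w; case: (Z w) (Y w) => ? ? [].
by rewrite !expectD//; exact: moments_integrable.
Qed.

Lemma cexpectZ c Z : cam Z -> cE (fun w => c * Z w) = c * cE Z.
Proof.
case: c => a b [Z1 Z2]; rewrite /cexpect.
have -> : (fun w => complex.Re (Complex a b * Z w)) =
    (fun w => a * complex.Re (Z w) + (- b) * complex.Im (Z w)).
  by apply/funext => w; case: (Z w) => x y /=; rewrite mulNr.
have -> : (fun w => complex.Im (Complex a b * Z w)) =
    (fun w => a * complex.Im (Z w) + b * complex.Re (Z w)).
  by apply/funext => w; case: (Z w) => x y /=.
have i1 := moments_integrable Z1; have i2 := moments_integrable Z2.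
rewrite (expectD (integrable_scaler a i1) (integrable_scaler (- b) i2)).
rewrite (expectD (integrable_scaler a i2) (integrable_scaler b i1)).
by rewrite !expectZ// mulNr.
Qed.

Lemma cexpect_lincomb (I : Type) (r : seq I) (c : I -> C) (F : I -> T -> C) :
  (forall i, cam (F i)) ->
  cE (fun w => \sum_(i <- r) c i * F i w) = \sum_(i <- r) c i * cE (F i).
Proof.
move=> aF; elim: r => [|i r IH].
  rewrite big_nil /cexpect.
  by under [X in Rintegral _ _ X]eq_fun do rewrite big_nil; rewrite !(expect_cst, big_nil)//=;
     under [X in Rintegral _ _ X]eq_fun do rewrite big_nil; rewrite !(expect_cst).
rewrite big_cons -IH -cexpectZ// -cexpectD.
- by congr cexpect; apply/funext => w; rewrite big_cons.
- by apply: cmoments_mul => //; exact: cmoments_cst.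
- by apply: cmoments_sum => j; apply: cmoments_mul => //; exact: cmoments_cst.
Qed.

Lemma cexpect_real F : cE (fun w => toC (F w)) = toC (E F).
Proof. by rewrite /cexpect /= expect_cst. Qed.

End complex_expectation.

Section quadratic_forms.
Context {R : realType} {d : measure_display} {T : measurableType d}.
Context (P : probability T R).
Local Notation C := R[i].
Local Notation normc := (@ComplexField.Normc.normc R).
Local Notation E F := (Rintegral P [set: T] F).
Local Notation cE := (cexpect P).
Local Notation cam := (complex_all_moments P).
Local Notation toC := (real_complex R).

Variable G : (T -> R) -> Prop.
Hypothesis GZD : forall (c : R) x y, G x -> G y -> G (c *: x + y).
Hypothesis G_meas : forall x, G x -> measurable_fun setT x.
Hypothesis G_gauss : forall x, G x -> centred_gaussian P x.
Variables (n : nat) (B : 'I_n -> T -> R) (g : 'I_n -> C).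
Hypothesis GB : forall i, G (B i).

Definition quadratic_form (w : T) : C := \sum_i g i * toC (B i w ^+ 2 - 1).
Local Notation Z := quadratic_form.

(** The derivative of the quadratic form in the direction [b], in the sense of
    [dseq_product]. *)
Definition quadratic_form_derivative (b : T -> R) (w : T) : C :=
  \sum_i g i * toC (2 * E (fun w => b w * B i w) * B i w).
Local Notation DZ := quadratic_form_derivative.

Let amB i : all_moments P (B i) := gaussian_all_moments G_meas G_gauss (GB i).

Lemma quadratic_form_all_moments : cam Z.
Proof.
apply: cmoments_sum => i; apply: cmoments_mul; first exact: cmoments_cst.
by apply: cmoments_real; apply: moments_sub; [exact: moments_pow|exact: moments_cst].
Qed.

Lemma quadratic_form_derivative_all_moments b : cam (DZ b).
Proof.
apply: cmoments_sum => i; apply: cmoments_mul; first exact: cmoments_cst.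
by apply: cmoments_real; exact: moments_scale.
Qed.

(** By induction on [p]: one factor [Z] is expanded, its variables [B i] join
    the list [l] twice, and the derivatives falling on them reassemble into
    [DZ b]. *)
Lemma stein_quadratic_form b l p : G b -> {in l, forall z, G z} ->
  cE (fun w => toC (b w * seq_product l w) * Z w ^+ p) =
  cE (fun w => toC (dseq_product P b l w) * Z w ^+ p) +
  p%:R * cE (fun w => toC (seq_product l w) * DZ b w * Z w ^+ p.-1).
Proof.
move=> Gb; elim: p l => [|p IH] l Gl.
  rewrite mul0r addr0.
  have -> : (fun w => toC (b w * seq_product l w) * Z w ^+ 0) =
      (fun w => toC (b w * seq_product l w)) by apply/funext => w; rewrite expr0 mulr1.
  have -> : (fun w => toC (dseq_product P b l w) * Z w ^+ 0) =
      (fun w => toC (dseq_product P b l w)) by apply/funext => w; rewrite expr0 mulr1.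
  by rewrite !cexpect_real (isserlis GZD G_meas G_gauss).
have GBBl i : {in B i :: B i :: l, forall z, G z}.
  by move=> z; rewrite !inE => /orP[/eqP->|/orP[/eqP->|/Gl]].
have ab := gaussian_all_moments G_meas G_gauss Gb.
have al := seq_product_all_moments G_meas G_gauss Gl.
have aBBl i := seq_product_all_moments G_meas G_gauss (GBBl i).
have adl := dseq_product_all_moments G_meas G_gauss b Gl.
have adBBl i := dseq_product_all_moments G_meas G_gauss b (GBBl i).
have aZ := quadratic_form_all_moments; have aDZ := quadratic_form_derivative_all_moments b.
pose F0 w := toC (b w * seq_product l w) * Z w ^+ p.
pose F i w := toC (b w * seq_product (B i :: B i :: l) w) * Z w ^+ p.
pose F1 i w := toC (dseq_product P b (B i :: B i :: l) w) * Z w ^+ p.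
pose F2 i w := toC (seq_product (B i :: B i :: l) w) * DZ b w * Z w ^+ p.-1.
pose F3 w := toC (dseq_product P b l w) * Z w ^+ p.
pose F4 w := toC (seq_product l w) * DZ b w * Z w ^+ p.-1.
have cF0 : cam F0 by apply: cmoments_mul (cmoments_pow p aZ); apply/cmoments_real/moments_mul.
have cF i : cam (F i) by apply: cmoments_mul (cmoments_pow p aZ); apply/cmoments_real/moments_mul.
have cF1 i : cam (F1 i) by apply: cmoments_mul (cmoments_pow p aZ); exact/cmoments_real.
have cF2 i : cam (F2 i).
  by apply: cmoments_mul (cmoments_pow p.-1 aZ); apply: cmoments_mul => //; exact/cmoments_real.
have cF3 : cam F3 by apply: cmoments_mul (cmoments_pow p aZ); exact/cmoments_real.
have cF4 : cam F4.
  by apply: cmoments_mul (cmoments_pow p.-1 aZ); apply: cmoments_mul => //; exact/cmoments_real.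
have cN f : cam f -> cam (fun w => - 1 * f w).
  by move=> ?; apply: cmoments_mul => //; exact: cmoments_cst.
have lhs : (fun w => toC (b w * seq_product l w) * Z w ^+ p.+1) =
    (fun w => \sum_i g i * (F i w + - 1 * F0 w)).
  apply/funext => w; rewrite exprSr mulrA mulrC /Z mulr_suml.
  apply: eq_bigr => i _; rewrite /F /F0 -mulrA; congr (_ * _).
  by rewrite !seq_product_cons !(rmorphM, rmorphB, rmorphXn, rmorph1)/=; ring.
rewrite lhs cexpect_lincomb; last by move=> i; apply: cmoments_add (cN _ _).
under eq_bigr => i _ do
  rewrite (cexpectD (cF i) (cN _ cF0)) (cexpectZ _ cF0) (IH _ (GBBl i)) (IH _ Gl).
pose S i w := F1 i w + p%:R * F2 i w + (- 1 * F3 w + (- p%:R) * F4 w).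
have cS i : cam (S i).
  by apply: cmoments_add; apply: cmoments_add => //; [|exact: cN|];
     apply: cmoments_mul => //; exact: cmoments_cst.
transitivity (\sum_i g i * cE (S i)).
  apply: eq_bigr => i _; congr (_ * _).
  have c1 : cam (fun w => p%:R * F2 i w) by apply: cmoments_mul => //; exact: cmoments_cst.
  have c2 : cam (fun w => - p%:R * F4 w) by apply: cmoments_mul => //; exact: cmoments_cst.
  rewrite /S (cexpectD (cmoments_add (cF1 i) c1) (cmoments_add (cN _ cF3) c2)).
  rewrite (cexpectD (cF1 i) c1) (cexpectD (cN _ cF3) c2) !cexpectZ//.
  by rewrite -/(F1 i) -/(F2 i) -/F3 -/F4; ring.
rewrite -cexpect_lincomb//.
pose F5 w := toC (dseq_product P b l w) * Z w ^+ p.+1.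
pose F6 w := toC (seq_product l w) * DZ b w * Z w ^+ p.
have cF5 : cam F5 by apply: cmoments_mul (cmoments_pow p.+1 aZ); exact/cmoments_real.
have cF6 : cam F6.
  by apply: cmoments_mul (cmoments_pow p aZ); apply: cmoments_mul => //; exact/cmoments_real.
rewrite -(cexpectZ p.+1%:R cF6) -cexpectD//; last first.
  by apply: cmoments_mul => //; exact: cmoments_cst.
congr cexpect; apply/funext => w.
have pZ : p%:R * Z w ^+ p = p%:R * Z w ^+ p.-1 * Z w.
  by case: (p) => [|q]; [rewrite !mul0r|rewrite exprSr mulrA].
have -> : p.+1%:R * F6 w = F6 w + toC (seq_product l w) * DZ b w * (p%:R * Z w ^+ p.-1) * Z w.
  transitivity (F6 w + toC (seq_product l w) * DZ b w * (p%:R * Z w ^+ p)).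
    by rewrite /F6 -natr1; ring.
  by rewrite pZ; ring.
transitivity (\sum_i (g i * toC (2 * E (fun w => b w * B i w) * B i w) *
    (toC (seq_product l w) * Z w ^+ p) +
   g i * toC (B i w ^+ 2 - 1) * (F3 w + p%:R * F4 w))).
  apply: eq_bigr => i _; rewrite /S /F1 /F2 /F3 /F4 /= !seq_product_cons.
  by rewrite !(rmorphM, rmorphD, rmorphB, rmorphXn, rmorph1)/=; ring.
rewrite big_split/= -!mulr_suml -/(Z w) -/(DZ b w) /F5 /F6 /F3 /F4 exprSr; ring.
Qed.

End quadratic_forms.

Section quadratic_form_moments.
Context {R : realType} {d : measure_display} {T : measurableType d}.
Context (P : probability T R).
Local Notation C := R[i].
Local Notation normc := (@ComplexField.Normc.normc R).
Local Notation intg F := (P.-integrable [set: T] (EFin \o F)).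
Local Notation E F := (Rintegral P [set: T] F).
Local Notation cE := (cexpect P).
Local Notation cam := (complex_all_moments P).
Local Notation toC := (real_complex R).

Variable G : (T -> R) -> Prop.
Hypothesis GZD : forall (c : R) x y, G x -> G y -> G (c *: x + y).
Hypothesis G_meas : forall x, G x -> measurable_fun setT x.
Hypothesis G_gauss : forall x, G x -> centred_gaussian P x.
Variables (n : nat) (B : 'I_n -> T -> R) (g : 'I_n -> C).
Hypothesis GB : forall i, G (B i).
Local Notation Z := (quadratic_form B g).
Let K i j : R := E (fun w => B i w * B j w).
Hypothesis K1 : forall i, K i i = 1.

Let amB i : all_moments P (B i) := gaussian_all_moments G_meas G_gauss (GB i).
Let aZ : cam Z := quadratic_form_all_moments G_meas G_gauss g GB.

Let KC i j : K i j = K j i.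
Proof. by rewrite /K; congr Rintegral; apply/funext => w; rewrite mulrC. Qed.

Let Gl2 i j : {in [:: B i; B j], forall z, G z}.
Proof. by move=> z; rewrite !inE => /orP[/eqP->|/eqP->]. Qed.

Lemma hermite_covariance i j :
  E (fun w => (B i w ^+ 2 - 1) * (B j w ^+ 2 - 1)) = 2 * K i j ^+ 2.
Proof.
have i2 k : intg (fun w => B k w ^+ 2) by exact: (amB k).2.
have E2 k : E (fun w => B k w ^+ 2) = 1 by rewrite -(K1 k).
have G3 : {in [:: B i; B j; B j], forall z, G z}.
  by move=> z; rewrite !inE => /orP[/eqP->|/orP[/eqP->|/eqP->]].
have a4 : all_moments P (fun w => B i w ^+ 2 * B j w ^+ 2).
  by apply: moments_mul; exact: moments_pow.
have a3 : intg (fun w => B i w * B j w) by apply: moments_integrable; exact: moments_mul.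
have E4 : E (fun w => B i w ^+ 2 * B j w ^+ 2) = 1 + 2 * K i j ^+ 2.
  have -> : (fun w => B i w ^+ 2 * B j w ^+ 2) =
      (fun w => B i w * seq_product [:: B i; B j; B j] w).
    by apply/funext => w; rewrite !seq_product_cons seq_product_nil; ring.
  rewrite (isserlis GZD G_meas G_gauss (GB i) G3).
  have -> : dseq_product P (B i) [:: B i; B j; B j] =
      (fun w => B j w ^+ 2 + (2 * K i j) * (B i w * B j w)).
    apply/funext => w; rewrite /= !seq_product_cons seq_product_nil -!/(K _ _) K1; ring.
  rewrite (expectD (i2 j) (integrable_scaler _ a3)) (expectZ _ a3) E2 -/(K i j); ring.
have -> : (fun w => (B i w ^+ 2 - 1) * (B j w ^+ 2 - 1)) =
    (fun w => B i w ^+ 2 * B j w ^+ 2 +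
      (-1 * B i w ^+ 2 + (-1 * B j w ^+ 2 + 1))).
  by apply/funext => w; ring.
have c1 := integrable_const_fun P 1.
have m1 := integrable_scaler (-1) (i2 i); have m2 := integrable_scaler (-1) (i2 j).
rewrite (expectD (moments_integrable a4) (integrable_addr m1 (integrable_addr m2 c1))).
rewrite (expectD m1 (integrable_addr m2 c1)).
rewrite (expectD m2 c1) (expectZ _ (i2 i)) (expectZ _ (i2 j)) expect_cst !E2 E4; ring.
Qed.

(** The sum on the right is the squared Hilbert-Schmidt norm of the tensor
    [\sum_i g i h_i (x) h_i] when [K i j] is the scalar product of [h_i] and
    [h_j]. *)
Lemma quadratic_form_norm2 :
  E (fun w => normc (Z w) ^+ 2) = 2 * \sum_i \sum_j
    (complex.Re (g i) * complex.Re (g j) + complex.Im (g i) * complex.Im (g j))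
    * K i j ^+ 2.
Proof.
have -> : (fun w => normc (Z w) ^+ 2) = (fun w => \sum_i \sum_j
    (complex.Re (g i) * complex.Re (g j) + complex.Im (g i) * complex.Im (g j)) *
    ((B i w ^+ 2 - 1) * (B j w ^+ 2 - 1))).
  apply/funext => w; rewrite normc_sqr /quadratic_form Re_sum Im_sum.
  under eq_bigr do rewrite Re_mul_real.
  under [X in _ + X ^+ 2]eq_bigr do rewrite Im_mul_real.
  rewrite !expr2 !mulr_suml -big_split/=; apply: eq_bigr => i _.
  rewrite !mulr_sumr -big_split/=; apply: eq_bigr => j _; ring.
have ah i j : intg (fun w => (B i w ^+ 2 - 1) * (B j w ^+ 2 - 1)).
  by apply: moments_integrable; apply: moments_mul;
     apply: moments_sub; (try exact: moments_pow); exact: moments_cst.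
rewrite expect_sum; last by move=> i; apply: integrable_sumr => j; exact: integrable_scaler.
rewrite mulr_sumr; apply: eq_bigr => i _.
rewrite expect_sum; last by move=> j; exact: integrable_scaler.
rewrite mulr_sumr; apply: eq_bigr => j _.
by rewrite expectZ// hermite_covariance; ring.
Qed.

Let KM : 'M[C]_n := \matrix_(i, j) toC (K i j).
Let D : 'M[C]_n := diag_mx (\row_i g i).

Let moment_mx p : 'M[C]_n :=
  \matrix_(i, j) cE (fun w => toC (B i w * B j w) * Z w ^+ p).

Let moment_mx0 : moment_mx 0 = KM.
Proof.
apply/matrixP => i j; rewrite !mxE -cexpect_real; congr cexpect.
by apply/funext => w; rewrite expr0 mulr1.
Qed.

(** Integration by parts with respect to [B j]: the derivative falls either on
    [B i], which gives the first term, or on one of the factors of [Z ^+ p.+1],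
    which gives the second. *)
Let moment_mxS p : moment_mx p.+1 =
  cE (fun w => Z w ^+ p.+1) *: KM + (2 * p.+1%:R) *: (moment_mx p *m D *m KM).
Proof.
apply/matrixP => i j; rewrite mxE.
have Gi : {in [:: B i], forall z, G z} by move=> z; rewrite inE => /eqP->.
have -> : (fun w => toC (B i w * B j w) * Z w ^+ p.+1) =
    (fun w => toC (B j w * seq_product [:: B i] w) * Z w ^+ p.+1).
  by apply/funext => w; rewrite seq_product_cons seq_product_nil mulr1 mulrC [B i w * _]mulrC mulrC.
rewrite (stein_quadratic_form GZD G_meas G_gauss g GB p.+1 (GB j) Gi).
rewrite !mxE; congr (_ + _).
  rewrite mulrC -cexpectZ; last exact: cmoments_pow.
  congr cexpect; apply/funext => w; rewrite /= seq_product_nil mulr1 mulr0 addr0.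
  by rewrite -/(K j i) KC.
rewrite -mulrA mulrCA; congr (_ * _).
have aF k : cam (fun w => toC (B i w * B k w) * Z w ^+ p).
  by apply: cmoments_mul (cmoments_pow p aZ); apply/cmoments_real/moments_mul.
have -> : (fun w => toC (seq_product [:: B i] w) * quadratic_form_derivative P B g (B j) w *
    Z w ^+ p.+1.-1) = (fun w => \sum_k (2 * toC (K k j) * g k) *
      (toC (B i w * B k w) * Z w ^+ p)).
  apply/funext => w; rewrite seq_product_cons seq_product_nil mulr1 /quadratic_form_derivative.
  rewrite mulr_sumr mulr_suml; apply: eq_bigr => k _.
  by rewrite -/(K j k) KC !rmorphM/= rmorph_nat; ring.
rewrite cexpect_lincomb// mulr_sumr; apply: eq_bigr => k _.
by rewrite /D mul_mx_diag !mxE; ring.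
Qed.

Let u p : C := cE (fun w => Z w ^+ p) / p`!%:R.

Let fact0C p : p`!%:R != 0 :> C.
Proof. by rewrite pnatr_eq0 -lt0n fact_gt0. Qed.

Let moment_mxE p : p`!%:R^-1 *: moment_mx p =
  \sum_(j < p.+1) (2 ^+ j * u (p - j)) *: gram_powers g KM j.
Proof.
elim: p => [|p IH].
  rewrite big_ord1 subn0 expr0 mul1r moment_mx0 /u.
  have -> : (fun w => Z w ^+ 0) = (fun w => toC 1) by apply/funext => w; rewrite expr0.
  by rewrite cexpect_real expect_cst mul1r.
rewrite moment_mxS scalerDr big_ord_recl subn0 expr0 mul1r scalerA; congr (_ + _).
  by rewrite mulrC.
have -> : (p.+1)`!%:R^-1 *: ((2 * p.+1%:R) *: (moment_mx p *m D *m KM)) =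
   2 *: ((p`!%:R^-1 *: moment_mx p) *m D *m KM).
  rewrite -!scalemxAl !scalerA; congr (_ *: _).
  by rewrite factS natrM; field; rewrite fact0C nat1r pnatr_eq0.
rewrite IH !mulmx_suml scaler_sumr; apply: eq_bigr => j _.
rewrite -!scalemxAl scalerA /gram_powers iterS -/D; congr (_ *: _).
by rewrite /= /bump add1n subSS exprS mulrA.
Qed.

(** The value at 0 is zero because the constant [- 1] in [B i ^+ 2 - 1] cancels
    the trace of [D *m KM]: this is the regularization in the Carleman-Fredholm
    determinant [det_2]. *)
Let c j : C := if j is j'.+1 then 2 ^+ j * \tr (D *m gram_powers g KM j) else 0.

(** Expanding one factor of [Z ^+ p.+1], its expectation is
    [\tr (D *m moment_mx p)] minus [\tr (D *m KM)] times that of [Z ^+ p], and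
    [moment_mxE] expands the first trace. *)
Let moment_recursion : log_derivative_recursion c u.
Proof.
split.
  rewrite /u; have -> : (fun w => Z w ^+ 0) = (fun w => toC 1).
    by apply/funext => w; rewrite expr0.
  by rewrite cexpect_real expect_cst fact0 divr1.
move=> p.
have trD (M : 'M[C]_n) : \tr (D *m M) = \sum_i g i * M i i.
  by rewrite /mxtrace; apply: eq_bigr => i _; rewrite /D mul_diag_mx !mxE.
have -> : p.+1%:R * u p.+1 = cE (fun w => Z w ^+ p.+1) / p`!%:R.
  by rewrite /u factS natrM; field; rewrite fact0C nat1r pnatr_eq0.
have -> : cE (fun w => Z w ^+ p.+1) = \tr (D *m moment_mx p) -
    \tr (D *m KM) * cE (fun w => Z w ^+ p).
  have aF i : cam (fun w => toC (B i w * B i w) * Z w ^+ p).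
    by apply: cmoments_mul (cmoments_pow p aZ); apply/cmoments_real/moments_mul.
  have aF' i : cam (fun w => toC (B i w * B i w) * Z w ^+ p + -1 * Z w ^+ p).
    by apply: cmoments_add => //; apply: cmoments_mul; [exact: cmoments_cst|exact: cmoments_pow].
  have -> : (fun w => Z w ^+ p.+1) = (fun w => \sum_i g i *
      (toC (B i w * B i w) * Z w ^+ p + -1 * Z w ^+ p)).
    apply/funext => w; rewrite exprS {1}/quadratic_form mulr_suml.
    by apply: eq_bigr => i _; rewrite expr2 rmorphB rmorph1/=; ring.
  rewrite cexpect_lincomb// !trD mulr_suml -sumrB; apply: eq_bigr => i _.
  rewrite cexpectD//; last by apply: cmoments_mul; [exact: cmoments_cst|exact: cmoments_pow].
  rewrite (cexpectZ _ (cmoments_pow p aZ)) /moment_mx /KM !mxE K1; ring.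
rewrite mulrBl [\tr _ / _]mulrC -mxtraceZ scalemxAr moment_mxE.
rewrite big_ord_recl mulmxDr mxtraceD subn0 expr0 mul1r.
rewrite [X in _ = X]big_ord_recl mul0r add0r -scalemxAr mxtraceZ.
rewrite -/(gram_powers g KM 0) -[X in _ - X]mulrA -/(u p) [u p * _]mulrC addrAC subrr add0r.
rewrite mulmx_sumr raddf_sum; apply: eq_bigr => j _ /=.
by rewrite -scalemxAr mxtraceZ /bump add1n; ring.
Qed.

(** By [gram_trace_le] the coefficients grow at most like the powers of twice a
    Hilbert-Schmidt norm, which [quadratic_form_norm2] expresses through the
    L^2 norm of [Z]; thus the growth rate depends on [Z] only through that
    norm, and not on [n] or on the vectors [B i]. *)
Lemma quadratic_form_recursion (L : 'M[R]_n) :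
  (forall i j, K i j = \sum_k L i k * L j k) ->
  exists2 c, log_derivative_recursion c (fun p => cE (fun w => Z w ^+ p) / p`!%:R) &
    forall s, 0 <= s -> 2 * E (fun w => normc (Z w) ^+ 2) <= s ^+ 2 ->
      forall j, normc (c j) <= s ^+ j.+1.
Proof.
move=> KL; exists c; first exact: moment_recursion.
move=> s s0; rewrite quadratic_form_norm2.
set q := \sum_i _ => qs [|j]; first by rewrite ComplexField.Normc.normc0 exprn_ge0.
rewrite /c ComplexField.Normc.normcM normcX normc_natr.
have := gram_trace_le g j KL; rewrite -/q => tq.
apply: (@le_trans _ _ (2 ^+ j.+1 * Num.sqrt q ^+ j.+2)); first by rewrite ler_wpM2l.
have rs : 2 * Num.sqrt q <= s.
  rewrite -[leLHS]ger0_norm ?mulr_ge0 ?sqrtr_ge0// -(ger0_norm s0).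
  rewrite -sqrtr_sqr -[leRHS]sqrtr_sqr ler_wsqrtr// exprMn.
  (* [Num.sqrt] vanishes on negative numbers, which spares proving [0 <= q]. *)
  have [q0|q0] := leP 0 q; first by rewrite sqr_sqrtr//; move: qs; lra.
  by rewrite ltr0_sqrtr// expr0n/= mulr0 sqr_ge0.
apply: (@le_trans _ _ ((2 * Num.sqrt q) ^+ j.+2)); last first.
  by rewrite lerXn2r ?nnegrE ?mulr_ge0 ?sqrtr_ge0.
rewrite exprMn ler_wpM2r ?exprn_ge0 ?sqrtr_ge0//.
by rewrite ler_weXn2l// ler1n.
Qed.

End quadratic_form_moments.

(** * The closure of the chaos polynomials *)

Section linear_combinations.
Context {K : pzRingType} {V : lmodType K}.

Definition lincomb_of (S : V -> Prop) (x : V) : Prop :=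
  exists n (c : 'I_n -> K) (v : 'I_n -> V),
    (forall i, S (v i)) /\ x = \sum_(i < n) c i *: v i.

Lemma lincomb_of_gen (S : V -> Prop) x : S x -> lincomb_of S x.
Proof.
move=> Sx; exists 1, (fun=> 1), (fun=> x); split => //.
by rewrite big_ord1 scale1r.
Qed.

Lemma lincomb_of_linear (S : V -> Prop) (a : K) x y :
  lincomb_of S x -> lincomb_of S y -> lincomb_of S (a *: x + y).
Proof.
move=> [m [c [v [Sv ->]]]] [n [e [w [Sw ->]]]].
exists (m + n)%N.
exists (fun i => match fintype.split i with inl j => a * c j | inr k => e k end).
exists (fun i => match fintype.split i with inl j => v j | inr k => w k end).
split; first by move=> i; case: (fintype.split i).
rewrite big_split_ord /= scaler_sumr; congr (_ + _); apply: eq_bigr => i _.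
  by rewrite (unsplitK (inl i : 'I_m + 'I_n)) scalerA.
by rewrite (unsplitK (inr i : 'I_m + 'I_n)).
Qed.

Lemma lincomb_of0 (S : V -> Prop) : lincomb_of S 0.
Proof.
exists 0, (fun=> 0), (fun=> 0); split; last by rewrite big_ord0.
by case.
Qed.

End linear_combinations.

Lemma min_dist_le {R : realDomainType} (x y M : R) :
  `|Num.min x M - Num.min y M| <= `|x - y|.
Proof.
have h1 := ler_norm (x - y); have := ler_norm (y - x); rewrite distrC.
move: `|x - y| h1 => b h1 h2; rewrite ler_norml; apply/andP.
by split; rewrite /Num.min; case: ltP => ?; case: ltP => ?; lra.
Qed.

Lemma ler_dist_expr {K : numDomainType} (M a b : K) n : `|a| <= M -> `|b| <= M ->
  `|a ^+ n - b ^+ n| <= n%:R * M ^+ n.-1 * `|a - b|.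
Proof.
move=> aM bM; rewrite subrXX normrM mulrC ler_wpM2r//.
apply: (le_trans (ler_norm_sum _ _ _)).
rewrite mulr_natl -[X in _ *+ X](card_ord n) -sumr_const.
apply: ler_sum => i _; rewrite normrM !normrX.
have -> : M ^+ n.-1 = M ^+ (n.-1 - i) * M ^+ i.
  by rewrite -exprD subnK// -ltnS (ltn_predK (ltn_ord i)).
have M0 : 0 <= M by exact: le_trans bM.
by rewrite ler_pM ?exprn_ge0// lerXn2r ?nnegrE.
Qed.

(** The missing mass [1 - \sum_i l i] is placed at 0; the exponential is bounded
    below by its tangent at the mean. *)
Lemma jensen_expR {R : realType} (I : finType) (l y : I -> R) :
  (forall i, 0 <= l i) -> \sum_i l i <= 1 ->
  expR (\sum_i l i * y i) <= 1 + \sum_i l i * expR (y i).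
Proof.
move=> l0 l1; set a := \sum_i _.
have h x : expR a * (1 + (x - a)) <= expR x.
  have -> : expR x = expR a * expR (x - a) by rewrite -expRD addrC subrK.
  by rewrite ler_wpM2l ?expR_ge0// expR_ge1Dx.
have h1 : expR a * (1 - a) <= 1 by have := h 0; rewrite sub0r expR0.
have h2 : \sum_i l i * (expR a * (1 + (y i - a))) <= \sum_i l i * expR (y i).
  by apply: ler_sum => i _; exact: ler_wpM2l.
have e2 : \sum_i l i * (expR a * (1 + (y i - a))) =
    expR a * ((\sum_i l i) * (1 - a) + a).
  rewrite mulrDr mulr_suml !mulr_sumr -big_split/=.
  by apply: eq_bigr => i _; ring.
move: h2; rewrite e2; set s := \sum_i l i in l1 *.
have := ler_wpM2l (_ : 0 <= 1 - s) h1; rewrite subr_ge0 => /(_ l1).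
have s0 : 0 <= s by apply: sumr_ge0.
rewrite mulr1; lra.
Qed.

(** The same tangent argument for the square. *)
Lemma jensen_sqr {R : realType} (I : finType) (l y : I -> R) :
  (forall i, 0 <= l i) -> \sum_i l i <= 1 ->
  (\sum_i l i * y i) ^+ 2 <= \sum_i l i * y i ^+ 2.
Proof.
move=> l0 l1; set a := \sum_i _.
have h2 : \sum_i l i * (2 * a * y i - a ^+ 2) <= \sum_i l i * y i ^+ 2.
  apply: ler_sum => i _; apply: ler_wpM2l => //.
  by have := sqr_ge0 (y i - a); rewrite sqrrB -mulr_natl; lra.
have e2 : \sum_i l i * (2 * a * y i - a ^+ 2) = 2 * a * a - (\sum_i l i) * a ^+ 2.
  transitivity (2 * a * (\sum_i l i * y i) - (\sum_i l i) * a ^+ 2) => //.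
  by rewrite [in RHS]mulr_sumr mulr_suml -sumrB; apply: eq_bigr => i _; ring.
have := ler_wpM2r (sqr_ge0 a) l1; move: h2; rewrite e2; lra.
Qed.

Section isonormal_chaos.
Context {R : realType} {d : measure_display} {T : measurableType d}.
Context (P : probability T R) (H : realHilbertType R) (W : H -> {RV P >-> R}).
Hypothesis HW : isonormal W.
Local Notation C := R[i].
Local Notation normc := (@ComplexField.Normc.normc R).
Local Notation intg F := (P.-integrable [set: T] (EFin \o F)).
Local Notation E F := (Rintegral P [set: T] F).
Local Notation cE := (cexpect P).
Local Notation cam := (complex_all_moments P).
Local Notation toC := (real_complex R).

Definition gaussian_space : (T -> R) -> Prop :=
  lincomb_of (fun f : T -> R => exists h, f = W h).

Lemma gaussian_spaceW h : gaussian_space (W h).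
Proof. by apply: lincomb_of_gen; exists h. Qed.

Lemma gaussian_space_linear (c : R) x y :
  gaussian_space x -> gaussian_space y -> gaussian_space (c *: x + y).
Proof. exact: lincomb_of_linear. Qed.

Lemma gaussian_spaceE x : gaussian_space x ->
  exists n (c : 'I_n -> R) (h : 'I_n -> H), x = fun w => \sum_(i < n) c i * W (h i) w.
Proof.
move=> [n [c [v [/(_ _)/cid vW ->]]]].
exists n, c, (fun i => sval (vW i)); apply/funext => w; rewrite fct_sumE.
by apply: eq_bigr => i _; rewrite -(svalP (vW i)).
Qed.

Lemma gaussian_space_measurable x : gaussian_space x -> measurable_fun setT x.
Proof.
move=> /gaussian_spaceE[n [c [h ->]]].
by apply: measurable_sum => i; apply: measurable_funM.
Qed.

Lemma gaussian_space_gaussian x : gaussian_space x -> centred_gaussian P x.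
Proof. by move=> /gaussian_spaceE[n [c [h ->]]]; exact: HW.1. Qed.

Lemma isonormal_covariance f h : E (fun w => W f w * W h w) = hdot f h.
Proof. by have := HW.2 f h; rewrite unlock /Rintegral => ->. Qed.

(** Complex coefficients are allowed because combinations of the components with
    weights [theta k] have to stay in this class. *)
Definition chaos_polynomial : (T -> C) -> Prop :=
  lincomb_of (fun f : T -> C =>
    exists2 h, `|h| = 1 & f = fun w => toC (W h w ^+ 2 - 1)).

Lemma chaos_polynomialE Z : chaos_polynomial Z ->
  exists n (g : 'I_n -> C) (h : 'I_n -> H), (forall i, `|h i| = 1) /\
    Z = quadratic_form (fun i => W (h i) : T -> R) g.
Proof.
move=> [n [g [v [hv ->]]]].
have /(_ _)/cid vW i : exists h, `|h| = 1 /\ v i = fun w => toC (W h w ^+ 2 - 1).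
  by have [h h1 ->] := hv i; exists h.
exists n, g, (fun i => sval (vW i)); split=> [i|]; first exact: (svalP (vW i)).1.
apply/funext => w; rewrite fct_sumE.
by apply: eq_bigr => i _; rewrite {1}(svalP (vW i)).2.
Qed.

Lemma chaos_polynomial_all_moments Z : chaos_polynomial Z -> cam Z.
Proof.
move=> /chaos_polynomialE[n [g [h [h1 ->]]]].
exact: (quadratic_form_all_moments gaussian_space_measurable gaussian_space_gaussian _
  (fun i => gaussian_spaceW (h i))).
Qed.

Lemma chaos_polynomial_recursion Z : chaos_polynomial Z ->
  exists2 c, log_derivative_recursion c (fun p => cE (fun w => Z w ^+ p) / p`!%:R) &
    forall s, 0 <= s -> 2 * E (fun w => normc (Z w) ^+ 2) <= s ^+ 2 ->
      forall j, normc (c j) <= s ^+ j.+1.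
Proof.
move=> /chaos_polynomialE[n [g [h [h1 ->]]]].
have [L hL] := gram_factorization h.
apply: (quadratic_form_recursion gaussian_space_linear gaussian_space_measurable
  gaussian_space_gaussian g (fun i => gaussian_spaceW (h i)) _ (L := L)).
  by move=> i; rewrite isonormal_covariance hdotxx h1 expr1n.
by move=> i j; rewrite isonormal_covariance.
Qed.

Definition real_chaos_polynomial (Y : T -> R) : Prop :=
  chaos_polynomial (fun w => toC (Y w)).
Local Notation RP := real_chaos_polynomial.

Lemma real_chaos_polynomial_all_moments Y : RP Y -> all_moments P Y.
Proof. by move=> /chaos_polynomial_all_moments[]. Qed.

(** The bound [recursion_le] on the coefficients of the generating series. *)
Lemma real_chaos_polynomial_moment Y s p : RP Y -> 0 <= s ->
  2 * E (fun w => Y w ^+ 2) <= s ^+ 2 ->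
  E (fun w => Y w ^+ p) <= p`!%:R * s ^+ p.
Proof.
move=> rY s0 Ys; have [c hc cs] := chaos_polynomial_recursion rY.
have {}cs := cs s s0.
have /cs {}cs : 2 * E (fun w => normc (toC (Y w)) ^+ 2) <= s ^+ 2.
  apply: le_trans Ys; rewrite le_eqVlt; apply/orP; left; apply/eqP.
  congr (2 * _); congr Rintegral; apply/funext => w.
  by rewrite normc_real real_normK ?num_real.
have := recursion_le s0 hc cs p.
have -> : (fun w => toC (Y w) ^+ p) = (fun w => toC (Y w ^+ p)).
  by apply/funext => w; rewrite rmorphXn.
rewrite cexpect_real ComplexField.Normc.normcM ComplexField.Normc.normcV.
rewrite normc_natr normc_real ler_pdivrMr ?ltr0n ?fact_gt0// mulrC.
by apply: le_trans; exact: ler_norm.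
Qed.

Lemma real_chaos_polynomial_linear (a : R) X Y :
  RP X -> RP Y -> RP (fun w => a * X w + Y w).
Proof.
move=> rX rY; have := lincomb_of_linear (toC a) rX rY.
congr chaos_polynomial; apply/funext => w.
by rewrite rmorphD rmorphM.
Qed.

Definition chaos_closure (V : T -> R) : Prop :=
  [/\ measurable_fun setT V, intg (fun w => V w ^+ 2) &
    forall e, 0 < e -> exists2 Y, RP Y & E (fun w => (V w - Y w) ^+ 2) < e].

Lemma chaos_closure_sub V Y : chaos_closure V -> RP Y ->
  chaos_closure (fun w => V w - Y w).
Proof.
move=> [mV iV aV] rY; have aY := real_chaos_polynomial_all_moments rY.
split.
- by apply: measurable_funB => //; exact: moments_measurable aY.
- apply: integrable_sqr_add => //.
    by apply: measurableT_comp => //; exact: moments_measurable aY.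
  by have := aY.2 2; congr (P.-integrable _ _); apply/funext => w /=; rewrite sqrrN.
- move=> e /aV[X rX hX]; exists (fun w => -1 * Y w + X w).
    exact: real_chaos_polynomial_linear.
  apply: le_lt_trans hX; rewrite le_eqVlt; apply/orP; left; apply/eqP.
  by congr Rintegral; apply/funext => w; congr (_ ^+ 2); ring.
Qed.

End isonormal_chaos.

Section chaos_closure_bounds.
Context {R : realType} {d : measure_display} {T : measurableType d}.
Context (P : probability T R) (H : realHilbertType R) (W : H -> {RV P >-> R}).
Hypothesis HW : isonormal W.
Local Notation intg F := (P.-integrable [set: T] (EFin \o F)).
Local Notation E F := (Rintegral P [set: T] F).
Local Notation RP := (real_chaos_polynomial W).
Local Notation CC := (chaos_closure W).

(** The inequality [2 |D| e <= e ^+ 2 + D ^+ 2] replaces Cauchy-Schwarz. *)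
Lemma expect_norm_le (D : T -> R) e : measurable_fun setT D ->
  intg (fun w => D w ^+ 2) -> 0 < e -> E (fun w => D w ^+ 2) <= e ^+ 2 ->
  intg (fun w => `|D w|) /\ E (fun w => `|D w|) <= e.
Proof.
move=> mD iD e0 De.
have le w : `|D w| <= e / 2 + (2 * e)^-1 * D w ^+ 2.
  rewrite -subr_ge0 (_ : _ - _ = (2 * e)^-1 * (`|D w| - e) ^+ 2); last first.
    by rewrite -[D w ^+ 2](real_normK (num_real _)); field; rewrite gt_eqF.
  by rewrite mulr_ge0 ?sqr_ge0// invr_ge0 mulr_ge0// ltW.
have iG : intg (fun w => e / 2 + (2 * e)^-1 * D w ^+ 2).
  by apply: integrable_addr; [exact: integrable_const_fun|exact: integrable_scaler].
have iN : intg (fun w => `|D w|).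
  apply: integrable_le_norm iG; first exact: measurableT_comp.
  by move=> w; rewrite normr_id.
split=> //; apply: (le_trans (expect_le iN iG le)).
rewrite (expectD (integrable_const_fun P _) (integrable_scaler _ iD)) expectZ// expect_cst.
apply: (@le_trans _ _ (e / 2 + (2 * e)^-1 * e ^+ 2)).
  by rewrite lerD2l ler_wpM2l// invr_ge0 mulr_ge0// ltW.
by rewrite le_eqVlt; apply/orP; left; apply/eqP; field; rewrite gt_eqF.
Qed.

(** Truncating at height [M] makes the map [V |-> min (|V|, M) ^+ (p * 2)]
    Lipschitz, so the truncated moments of [V] are limits of those of chaos
    polynomials and inherit their bound; Fatou's lemma removes the truncation.
    The strict inequality between [2 * E V ^+ 2] and [t ^+ 2] leaves the room for
    the approximants to satisfy the same bound with [t]. *)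
Lemma chaos_closure_moment V t p : CC V -> 0 <= t ->
  2 * E (fun w => V w ^+ 2) < t ^+ 2 ->
  intg (fun w => V w ^+ (p * 2)) /\
  E (fun w => V w ^+ (p * 2)) <= (p * 2)`!%:R * t ^+ (p * 2).
Proof.
move=> [mV iV aV] t0 Vt; set n := (p * 2)%N.
set v := 2 * E (fun w => V w ^+ 2) in Vt.
have v0 : 0 <= v by rewrite mulr_ge0// expect_ge0// => w; exact: sqr_ge0.
(* [eta] and, below, [e1] are chosen so that in
   Y ^+ 2 <= (1 + eta) V ^+ 2 + (1 + eta^-1) (V - Y) ^+ 2
   each error term uses up at most half of the gap t ^+ 2 - v. *)
pose eta := (t ^+ 2 - v) / (2 * (v + 1)).
have eta0 : 0 < eta by rewrite divr_gt0 ?subr_gt0// mulr_gt0//; lra.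
have etav : eta * v <= (t ^+ 2 - v) / 2.
  rewrite /eta -(ler_pM2r (_ : 0 < v + 1)); last lra.
  have -> : (t ^+ 2 - v) / (2 * (v + 1)) * v * (v + 1) = (t ^+ 2 - v) / 2 * v.
    by field; apply: lt0r_neq0; lra.
  by rewrite ler_wpM2l ?divr_ge0 ?subr_ge0 1?ltW//; lra.
have approx del : 0 < del -> exists2 Y, RP Y &
    2 * E (fun w => Y w ^+ 2) <= t ^+ 2 /\
    (intg (fun w => `|V w - Y w|) /\ E (fun w => `|V w - Y w|) <= del).
  move=> del0.
  pose e1 := (t ^+ 2 - v) / (4 * (1 + eta^-1)).
  have e10 : 0 < e1.
    by rewrite divr_gt0 ?subr_gt0// mulr_gt0// addr_gt0// invr_gt0.
  have [|Y rY hY] := aV (Num.min e1 (del ^+ 2)).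
    by rewrite lt_min e10 exprn_gt0.
  move: hY; rewrite lt_min => /andP[hY1 hY2].
  have [mD iD _] := chaos_closure_sub HW (And3 mV iV aV) rY.
  exists Y => //; split; last by apply: expect_norm_le => //; exact: ltW.
  have aY := real_chaos_polynomial_all_moments HW rY.
  have i1 := integrable_scaler (1 + eta) iV; have i2 := integrable_scaler (1 + eta^-1) iD.
  have le w : Y w ^+ 2 <= (1 + eta) * V w ^+ 2 + (1 + eta^-1) * (V w - Y w) ^+ 2.
    rewrite -subr_ge0 (_ : _ - _ = eta^-1 * ((1 + eta) * V w - Y w) ^+ 2); last first.
      by field; rewrite gt_eqF.
    by rewrite mulr_ge0 ?sqr_ge0// invr_ge0 ltW.
  have := expect_le (aY.2 2) (integrable_addr i1 i2) le.
  rewrite (expectD i1 i2) (expectZ _ iV) (expectZ _ iD) => hE.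
  have he : (1 + eta^-1) * E (fun w => (V w - Y w) ^+ 2) <= (t ^+ 2 - v) / 4.
    have -> : (t ^+ 2 - v) / 4 = (1 + eta^-1) * e1.
      rewrite /e1; field; rewrite gt_eqF//= gt_eqF//.
      by rewrite addr_gt0.
    by rewrite ler_wpM2l ?ltW// addr_gt0// invr_gt0.
  have hv : E (fun w => V w ^+ 2) = v / 2 by rewrite /v mulrC mulKf.
  by rewrite hv in hE; lra.
pose f M w := Num.min `|V w| M.
have f0 M w : 0 <= M -> 0 <= f M w by move=> M0; rewrite le_min normr_ge0.
have mf (M : R) : measurable_fun setT (f M).
  by apply: measurable_minr => //; exact: measurableT_comp.
have iM (M : R) m : 0 <= M -> intg (fun w => f M w ^+ m).
  move=> M0; apply: integrable_le_norm (integrable_const_fun P (M ^+ m)).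
    exact: measurable_funX.
  move=> w; rewrite ger0_norm ?exprn_ge0 ?f0// lerXn2r ?nnegrE ?f0//.
  by rewrite ge_min lexx orbT.
have trunc (M : nat) : E (fun w => f M%:R w ^+ n) <= n`!%:R * t ^+ n.
  apply/ler_addgt0Pr => e e0.
  pose k := n%:R * (M%:R : R) ^+ n.-1.
  have k0 : 0 <= k by rewrite mulr_ge0// exprn_ge0.
  have [|Y rY [Yt [iD Dd]]] := approx (e / (k + 1)).
    by rewrite divr_gt0//; lra.
  have aY := real_chaos_polynomial_all_moments HW rY.
  have le w : f M%:R w ^+ n <= Y w ^+ n + k * `|V w - Y w|.
    pose y := Num.min `|Y w| M%:R.
    have y0 : 0 <= y by rewrite le_min normr_ge0/=.
    have yn : y ^+ n <= Y w ^+ n.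
      have -> : Y w ^+ n = `|Y w| ^+ n.
        by rewrite /n mulnC !exprM real_normK ?num_real.
      by rewrite lerXn2r ?nnegrE// ge_min lexx.
    have h1 : `|f M%:R w ^+ n - y ^+ n| <= k * `|f M%:R w - y|.
      apply: ler_dist_expr; rewrite ger0_norm ?f0// ge_min lexx orbT//.
    have h2 : `|f M%:R w - y| <= `|V w - Y w|.
      exact: le_trans (min_dist_le _ _ _) (ler_dist_dist _ _).
    have h3 := ler_wpM2l k0 h2.
    by move: (ler_norm (f M%:R w ^+ n - y ^+ n)); lra.
  have := expect_le (iM M%:R n (ler0n _ _)) (integrable_addr (aY.2 n) (integrable_scaler k iD)) le.
  rewrite (expectD (aY.2 n) (integrable_scaler k iD)) (expectZ _ iD) => hE.
  have hm := real_chaos_polynomial_moment HW n rY t0 Yt.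
  apply: (le_trans hE); apply: lerD => //.
  apply: (@le_trans _ _ ((k + 1) * (e / (k + 1)))).
    by apply: ler_pM => //; [exact: expect_ge0|lra].
  by rewrite mulrC divfK// gt_eqF//; lra.
have bound : (\int[P]_w (V w ^+ n)%:E <= (n`!%:R * t ^+ n)%:E)%E.
  apply: (@fatou_bound _ _ _ _ (fun M w => f M%:R w ^+ n)).
  - by move=> M; exact: measurable_funX.
  - by move=> M w; rewrite exprn_ge0// f0.
  - move=> w; have -> : V w ^+ n = `|V w| ^+ n.
      by rewrite /n mulnC !exprM real_normK ?num_real.
    apply: cvg_near_cst; exists (Num.truncn `|V w|).+1 => // M /= hM.
    rewrite /f min_l//; apply: (@le_trans _ _ (Num.truncn `|V w|).+1%:R).
      by rewrite ltW// truncnS_gt.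
    by rewrite ler_nat.
  - by move=> M; rewrite expect_fine ?iM// lee_fin.
have iVn : intg (fun w => V w ^+ n).
  apply: (integrable_of_integral_le _ _ bound (ltry _)); first exact: measurable_funX.
  by move=> w; rewrite /n exprM sqr_ge0.
by split=> //; rewrite -lee_fin -expect_fine.
Qed.

Lemma chaos_closure_all_moments V : CC V -> all_moments P V.
Proof.
move=> cV; have [mV iV aV] := cV.
have v0 : 0 <= 2 * E (fun w => V w ^+ 2).
  by rewrite mulr_ge0// expect_ge0// => w; exact: sqr_ge0.
pose t := 2 * E (fun w => V w ^+ 2) + 1.
have t0 : 0 <= t by rewrite /t; lra.
have Vt : 2 * E (fun w => V w ^+ 2) < t ^+ 2.
  rewrite /t expr2; set x := 2 * _ in v0 *; nra.
apply: (@moments_dominated _ _ _ _ _ (fun p w => 1 + V w ^+ (p * 2))) => //.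
- move=> p w; rewrite mulnC exprM -[V w ^+ 2](real_normK (num_real _)) -exprM mulnC exprM.
  set x := `|V w| ^+ p; have : 0 <= x by exact: exprn_ge0.
  by move=> _; rewrite -subr_ge0 (_ : _ - _ = (x - 2^-1) ^+ 2 + 3 / 4) ?addr_ge0 ?sqr_ge0//; field.
- move=> p; apply: integrable_addr; first exact: integrable_const_fun.
  exact: (chaos_closure_moment p cV t0 Vt).1.
Qed.

(** [expR (a * |V|)] is at most the sum of [expR (a * V)] and [expR (- a * V)], in
    whose expansion only even moments occur; by [chaos_closure_moment] the
    expectations of the terms are dominated by a geometric series in [S ^+ 2]. *)
Lemma chaos_closure_exp V t a S : CC V -> 0 <= t ->
  2 * E (fun w => V w ^+ 2) < t ^+ 2 -> 0 <= a -> a * t <= S -> S < 1 ->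
  (\int[P]_w (expR (a * `|V w|))%:E <= (2 / (1 - S ^+ 2))%:E)%E.
Proof.
move=> cV t0 Vt a0 atS S1; have [mV _ _] := cV.
have S0 : 0 <= S by apply: le_trans atS; exact: mulr_ge0.
pose F N w := \sum_(p < N) 2 * ((a * V w) ^+ (p * 2) / (p * 2)`!%:R).
have FE N w : F N w = \sum_(k < N * 2) (a * V w) ^+ k / k`!%:R +
    \sum_(k < N * 2) (- (a * V w)) ^+ k / k`!%:R.
  elim: N => [|N IH]; first by rewrite /F !big_ord0 addr0.
  rewrite /F big_ord_recr/= -/(F N w) IH mulSn !big_ord_recr/=.
  have sgn : (-1) ^+ (N * 2) = 1 :> R by rewrite mulnC exprM sqrrN !expr1n.
  rewrite [(- (a * V w)) ^+ (N * 2)]exprNn [(- (a * V w)) ^+ _.+1]exprNn.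
  by rewrite [(-1) ^+ _.+1]exprS sgn; ring.
have iV p := (chaos_closure_moment p cV t0 Vt).1.
have iF N : intg (F N).
  apply: integrable_sumr => p; apply: integrable_scaler.
  have -> : (fun w => (a * V w) ^+ (p * 2) / (p * 2)`!%:R) =
      (fun w => a ^+ (p * 2) / (p * 2)`!%:R * V w ^+ (p * 2)).
    by apply/funext => w; rewrite exprMn mulrAC.
  exact: integrable_scaler.
apply: (@le_trans _ _ (\int[P]_w (expR (a * V w) + expR (- (a * V w)))%:E)%E).
  apply: ge0_le_integral => //.
  - apply/measurable_EFinP; apply: measurableT_comp => //.
    by apply: measurable_funM => //; exact: measurableT_comp.
  - apply/measurable_EFinP; apply: measurable_funD; apply: measurableT_comp => //.
      exact: measurable_funM.
    by apply: measurableT_comp => //; exact: measurable_funM.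
  - move=> w _; rewrite lee_fin -{1}(ger0_norm a0) -normrM; exact: expR_normr_le.
apply: (@fatou_bound _ _ _ _ F).
- move=> N; apply: measurable_sum => p; apply: measurable_funM => //.
  by apply: measurable_funM => //; apply: measurable_funX; exact: measurable_funM.
- move=> N w; apply: sumr_ge0 => p _; rewrite mulr_ge0// divr_ge0//.
  by rewrite exprM sqr_ge0.
- move=> w; have -> : (fun N => F N w) =
      (fun N => \sum_(k < N * 2) (a * V w) ^+ k / k`!%:R +
        \sum_(k < N * 2) (- (a * V w)) ^+ k / k`!%:R).
    by apply/funext => N; exact: FE.
  have c (x : R) : \sum_(k < N * 2) x ^+ k / k`!%:R @[N --> \oo] --> expR x.
    apply: (@cvg_comp _ _ _ (fun N => N * 2)%N
      (fun N => \sum_(k < N) x ^+ k / k`!%:R)); last exact: exp_sum_cvg.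
    exact: cvg_mulnr.
  by apply: cvgD; exact: c.
- move=> N; rewrite expect_fine// lee_fin /F expect_sum; last first.
    move=> p; apply: integrable_scaler.
    have -> : (fun w => (a * V w) ^+ (p * 2) / (p * 2)`!%:R) =
        (fun w => a ^+ (p * 2) / (p * 2)`!%:R * V w ^+ (p * 2)).
      by apply/funext => w; rewrite exprMn mulrAC.
    exact: integrable_scaler.
  apply: (@le_trans _ _ (\sum_(p < N) 2 * (S ^+ 2) ^+ p)); last first.
    rewrite -mulr_sumr ler_wpM2l// geometric_sum_le// exprn_ge0//=.
    by rewrite expr_lt1.
  apply: ler_sum => p _.
  have -> : (fun w => 2 * ((a * V w) ^+ (p * 2) / (p * 2)`!%:R)) =
      (fun w => (2 * (a ^+ (p * 2) / (p * 2)`!%:R)) * V w ^+ (p * 2)).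
    by apply/funext => w; rewrite exprMn; ring.
  rewrite expectZ//; apply: (@le_trans _ _
    (2 * (a ^+ (p * 2) / (p * 2)`!%:R) * ((p * 2)`!%:R * t ^+ (p * 2)))).
    rewrite ler_wpM2l//; last exact: (chaos_closure_moment p cV t0 Vt).2.
    by rewrite mulr_ge0// divr_ge0// exprn_ge0.
  have -> : 2 * (a ^+ (p * 2) / (p * 2)`!%:R) * ((p * 2)`!%:R * t ^+ (p * 2)) =
      2 * (a * t) ^+ (p * 2).
    by rewrite exprMn; field; rewrite pnatr_eq0 -lt0n fact_gt0.
  rewrite ler_wpM2l// mulnC exprM lerXn2r ?nnegrE ?exprn_ge0 ?mulr_ge0//.
  by rewrite lerXn2r ?nnegrE ?mulr_ge0.
Qed.

(** Several variables are reduced to one by convexity: [\sum_i q i * |V i|] is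
    the combination, with weights [lam i] of total mass at most 1, of the
    variables [S / t i * |V i|], each of which has the size allowed by [S]. This
    plays the role of Minkowski's inequality. *)
Section weighted_families.
Variables (I : finType) (V : I -> T -> R) (t q : I -> R) (S : R).
Hypothesis cV : forall i, CC (V i).
Hypothesis t0 : forall i, 0 < t i.
Hypothesis Vt : forall i, 2 * E (fun w => V i w ^+ 2) < t i ^+ 2.
Hypothesis q0 : forall i, 0 <= q i.
Hypothesis S0 : 0 < S.
Hypothesis qtS : \sum_i q i * t i <= S.

Let lam i : R := q i * t i / S.
Let lam0 i : 0 <= lam i.
Proof. by rewrite divr_ge0 ?mulr_ge0// ltW. Qed.
Let lam1 : \sum_i lam i <= 1.
Proof. by rewrite -mulr_suml ler_pdivrMr// mul1r. Qed.
Let lamE w : \sum_i q i * `|V i w| = \sum_i lam i * (S / t i * `|V i w|).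
Proof.
apply: eq_bigr => i _; rewrite /lam; field.
by rewrite (gt_eqF S0) (gt_eqF (t0 i)).
Qed.

Let mV i : measurable_fun setT (V i).
Proof. by have [] := cV i. Qed.

Let mN i : measurable_fun setT (fun w => `|V i w|).
Proof. exact: measurableT_comp. Qed.

Lemma family_exp : S < 1 ->
  intg (fun w => expR (\sum_i q i * `|V i w|)) /\
  E (fun w => expR (\sum_i q i * `|V i w|)) <= 1 + 2 / (1 - S ^+ 2).
Proof.
move=> S1.
have tS i : S / t i * t i <= S by rewrite divfK ?gt_eqF.
have bi i := chaos_closure_exp (cV i) (ltW (t0 i)) (Vt i)
  (divr_ge0 (ltW S0) (ltW (t0 i))) (tS i) S1.
have ii i : intg (fun w => expR (S / t i * `|V i w|)).
  apply: (integrable_of_integral_le _ _ (bi i) (ltry _)); last by move=> w; exact: expR_ge0.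
  by apply: measurableT_comp => //; exact: measurable_funM.
have ib : intg (fun w => 1 + \sum_i lam i * expR (S / t i * `|V i w|)).
  apply: integrable_addr; first exact: integrable_const_fun.
  by apply: integrable_sumr => i; exact: integrable_scaler.
have le w : expR (\sum_i q i * `|V i w|) <= 1 + \sum_i lam i * expR (S / t i * `|V i w|).
  by rewrite lamE; exact: jensen_expR.
have i0 : intg (fun w => expR (\sum_i q i * `|V i w|)).
  apply: integrable_le_norm ib; last by move=> w; rewrite ger0_norm ?expR_ge0.
  apply: measurableT_comp => //; apply: measurable_sum => i.
  exact: measurable_funM.
split=> //; apply: (le_trans (expect_le i0 ib le)).
rewrite (expectD (integrable_const_fun P _)); last first.
  by apply: integrable_sumr => i; exact: integrable_scaler.
rewrite expect_cst lerD2l expect_sum; last by move=> i; exact: integrable_scaler.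
have k0 : 0 <= 2 / (1 - S ^+ 2) by rewrite divr_ge0// subr_ge0 exprn_ile1// ltW.
apply: (@le_trans _ _ (\sum_i lam i * (2 / (1 - S ^+ 2)))); last first.
  by rewrite -mulr_suml ler_piMl.
apply: ler_sum => i _; rewrite expectZ// ler_wpM2l//.
by rewrite -lee_fin -expect_fine.
Qed.

Lemma family_sqr : 2 * E (fun w => (\sum_i q i * `|V i w|) ^+ 2) <= S ^+ 2.
Proof.
have ii i : intg (fun w => V i w ^+ 2) by have [] := cV i.
have iZ i : intg (fun w => lam i * ((S / t i) ^+ 2 * V i w ^+ 2)).
  by apply: integrable_scaler; exact: integrable_scaler.
have le w : (\sum_i q i * `|V i w|) ^+ 2 <=
    \sum_i lam i * ((S / t i) ^+ 2 * V i w ^+ 2).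
  rewrite lamE; apply: (le_trans (jensen_sqr _ lam0 lam1)).
  by apply: ler_sum => i _; rewrite exprMn real_normK ?num_real.
have i0 : intg (fun w => (\sum_i q i * `|V i w|) ^+ 2).
  apply: (@integrable_le_norm _ _ _ _ _ (fun w => \sum_i lam i * ((S / t i) ^+ 2 * V i w ^+ 2))).
  - by apply: measurable_funX; apply: measurable_sum => i; exact: measurable_funM.
  - by move=> w; rewrite ger0_norm ?sqr_ge0.
  - exact: integrable_sumr.
have := expect_le i0 (integrable_sumr _ iZ) le; rewrite expect_sum// => h.
apply: (@le_trans _ _ (2 * \sum_i lam i * (S ^+ 2 / 2))); last first.
  rewrite -mulr_suml (_ : 2 * _ = (\sum_i lam i) * S ^+ 2); last by field.
  by rewrite ler_piMl// sqr_ge0.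
rewrite ler_wpM2l//; apply: (le_trans h); apply: ler_sum => i _.
rewrite (expectZ _ (integrable_scaler _ (ii i))) (expectZ _ (ii i)) ler_wpM2l//.
have -> : S ^+ 2 / 2 = (S / t i) ^+ 2 * (t i ^+ 2 / 2).
  by rewrite expr_div_n; field; rewrite gt_eqF.
by rewrite ler_wpM2l ?sqr_ge0//; have := Vt i; lra.
Qed.

End weighted_families.
End chaos_closure_bounds.

(** * The exponential series of a complex number *)

Section complex_exponential.
Context {R : realType}.
Local Notation C := R[i].
Local Notation normc := (@ComplexField.Normc.normc R).
Local Notation toC := (real_complex R).
Implicit Types (x y t : R) (z : C).

Lemma is_derive_scale x t : is_derive t 1 (fun t : R => x * t) x.
Proof.
have h : is_derive t 1 (x \*: (id : R -> R)) (x *: 1) by exact: is_deriveZ.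
by apply: is_derive_eq h _; rewrite /GRing.scale/= mulr1.
Qed.

Lemma is_derive_expR_cos x y t :
  is_derive t 1 (fun t => expR (x * t) * cos (y * t))
    (x * (expR (x * t) * cos (y * t)) - y * (expR (x * t) * sin (y * t))).
Proof.
have h1 := is_derive1_comp (is_derive_expR (x * t)) (is_derive_scale x t).
have h2 := is_derive1_comp (is_derive_cos (y * t)) (is_derive_scale y t).
by apply: is_derive_eq (is_deriveM h1 h2) _; rewrite /GRing.scale/=; ring.
Qed.

Lemma is_derive_expR_sin x y t :
  is_derive t 1 (fun t => expR (x * t) * sin (y * t))
    (x * (expR (x * t) * sin (y * t)) + y * (expR (x * t) * cos (y * t))).
Proof.
have h1 := is_derive1_comp (is_derive_expR (x * t)) (is_derive_scale x t).
have h2 := is_derive1_comp (is_derive_sin (y * t)) (is_derive_scale y t).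
by apply: is_derive_eq (is_deriveM h1 h2) _; rewrite /GRing.scale/=; ring.
Qed.

Lemma is_derive_monomial (a : R) n t :
  is_derive t 1 (fun t => t ^+ n.+1 * (a / n.+1`!%:R)) (t ^+ n * (a / n`!%:R)).
Proof.
have h : is_derive t 1 ((a / n.+1`!%:R) \*: ((id : R -> R) ^+ n.+1))
    ((a / n.+1`!%:R) *: ((n.+1%:R * t ^+ n) *: 1)).
  by apply: is_deriveZ; exact: is_deriveX.
have -> : (fun t => t ^+ n.+1 * (a / n.+1`!%:R)) =
    (a / n.+1`!%:R) \*: ((id : R -> R) ^+ n.+1).
  by apply/funext => s; rewrite mulrC !fctE.
apply: is_derive_eq h _; rewrite /GRing.scale/= factS natrM; field.
by rewrite pnatr_eq0 -lt0n fact_gt0 nat1r pnatr_eq0.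
Qed.

Definition exp_remainder_Re z n t : R :=
  expR (complex.Re z * t) * cos (complex.Im z * t) -
  \sum_(k < n) t ^+ k * (complex.Re (z ^+ k) / k`!%:R).

Definition exp_remainder_Im z n t : R :=
  expR (complex.Re z * t) * sin (complex.Im z * t) -
  \sum_(k < n) t ^+ k * (complex.Im (z ^+ k) / k`!%:R).

(** Along the ray [t |-> t z], the derivative of the remainder of order [n.+1] is
    [z] times the remainder of order [n]. *)
Lemma is_derive_exp_remainder z n t :
  is_derive t 1 (exp_remainder_Re z n.+1)
    (complex.Re z * exp_remainder_Re z n t - complex.Im z * exp_remainder_Im z n t) /\
  is_derive t 1 (exp_remainder_Im z n.+1)
    (complex.Re z * exp_remainder_Im z n t + complex.Im z * exp_remainder_Re z n t).
Proof.
set x := complex.Re z; set y := complex.Im z.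
elim: n => [|n [IH1 IH2]].
  split.
    have -> : exp_remainder_Re z 1 = (fun t => expR (x * t) * cos (y * t)) - cst 1.
      apply/funext => s; rewrite /exp_remainder_Re big_ord1.
      by rewrite !expr0 mul1r fact0 divr1.
    have h0 := is_derive_cst (1 : R) t (1 : R).
    have h := is_deriveB (is_derive_expR_cos x y t) h0.
    apply: is_derive_eq h _.
    by rewrite /exp_remainder_Re /exp_remainder_Im !big_ord0 !subr0.
  have -> : exp_remainder_Im z 1 = (fun t => expR (x * t) * sin (y * t)).
    apply/funext => s; rewrite /exp_remainder_Im big_ord1.
    by rewrite !expr0 mul1r mul0r subr0.
  apply: is_derive_eq (is_derive_expR_sin x y t) _.
  by rewrite /exp_remainder_Re /exp_remainder_Im !big_ord0 !subr0.
split.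
  have -> : exp_remainder_Re z n.+2 = exp_remainder_Re z n.+1 -
      (fun t => t ^+ n.+1 * (complex.Re (z ^+ n.+1) / n.+1`!%:R)).
    by apply/funext => s; rewrite /exp_remainder_Re big_ord_recr/= opprD addrA.
  apply: is_derive_eq (is_deriveB IH1 (is_derive_monomial _ n t)) _.
  by rewrite /exp_remainder_Re /exp_remainder_Im !big_ord_recr/= exprS ReM -/x -/y; ring.
have -> : exp_remainder_Im z n.+2 = exp_remainder_Im z n.+1 -
    (fun t => t ^+ n.+1 * (complex.Im (z ^+ n.+1) / n.+1`!%:R)).
  by apply/funext => s; rewrite /exp_remainder_Im big_ord_recr/= opprD addrA.
apply: is_derive_eq (is_deriveB IH2 (is_derive_monomial _ n t)) _.
rewrite /exp_remainder_Re /exp_remainder_Im !big_ord_recr/= exprS ImM -/x -/y; ring.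
Qed.

Lemma derive_ge0_le (f df : R -> R) :
  (forall t, is_derive t 1 f (df t)) -> (forall t, 0 <= t <= 1 -> 0 <= df t) ->
  forall t, 0 <= t <= 1 -> f 0 <= f t.
Proof.
move=> fd df0 t t01.
have dd s : derivable f s 1 by have [] := fd s.
have t01' : t \in `[0, 1] by rewrite in_itv.
have o01 : (0 : R) \in `[0, 1] by rewrite in_itv/= lexx ler01.
apply: (ger0_derive1_le_cc _ _ _ o01 t01'); last by case/andP: t01.
- by move=> s _.
- move=> s; rewrite in_itv/= => /andP[s0 s1].
  by rewrite derive1E (@derive_val _ _ _ _ _ _ _ (fd s)) df0// !ltW.
- by apply: derivable_within_continuous => s _.
Qed.

(** By induction on [n], integrating the bound for the derivative given by
    [is_derive_exp_remainder]. *)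
Lemma exp_remainder_le z n t : 0 <= t <= 1 ->
  let a := `|complex.Re z| + `|complex.Im z| in
  `|exp_remainder_Re z n t| <= expR a * (t ^+ n * (a ^+ n / n`!%:R)) /\
  `|exp_remainder_Im z n t| <= expR a * (t ^+ n * (a ^+ n / n`!%:R)).
Proof.
move=> t01 a; set x := complex.Re z; set y := complex.Im z.
elim: n t t01 => [|n IH] t t01; have /andP[t0 t1] := t01.
  have xt : x * t <= a.
    apply: (@le_trans _ _ `|x|); last by rewrite lerDl.
    apply: (le_trans (ler_norm _)); rewrite normrM (ger0_norm t0).
    by rewrite ler_piMr.
  rewrite /exp_remainder_Re /exp_remainder_Im !big_ord0 !subr0 !expr0 fact0 divr1 !mulr1.
  rewrite !normrM !(ger0_norm (expR_ge0 _)); split.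
    by rewrite -[leRHS]mulr1 ler_pM ?expR_ge0 ?ler_expR ?cos_max.
  by rewrite -[leRHS]mulr1 ler_pM ?expR_ge0 ?ler_expR ?sin_max.
pose b t := expR a * (t ^+ n * (a ^+ n.+1 / n`!%:R)).
have db (s : R) : is_derive s 1 (fun t => expR a * (t ^+ n.+1 * (a ^+ n.+1 / n.+1`!%:R))) (b s).
  have h : is_derive s 1 (expR a \*: (fun t => t ^+ n.+1 * (a ^+ n.+1 / n.+1`!%:R)))
      (expR a *: (s ^+ n * (a ^+ n.+1 / n`!%:R))).
    by apply: is_deriveZ; exact: is_derive_monomial.
  by apply: is_derive_eq h _.
have key u v s : 0 <= s <= 1 ->
    `|u| <= expR a * (s ^+ n * (a ^+ n / n`!%:R)) ->
    `|v| <= expR a * (s ^+ n * (a ^+ n / n`!%:R)) ->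
    `|x * u| + `|y * v| <= b s.
  move=> s01 hu hv; rewrite !normrM.
  have -> : b s = `|x| * (expR a * (s ^+ n * (a ^+ n / n`!%:R))) +
                  `|y| * (expR a * (s ^+ n * (a ^+ n / n`!%:R))).
    by rewrite /b exprS /a -/x -/y; ring.
  by apply: lerD; apply: ler_wpM2l.
have r0 (f g : R -> R) : (forall s : R, is_derive s 1 f (g s)) ->
    (forall s, 0 <= s <= 1 -> `|g s| <= b s) -> f 0 = 0 ->
    `|f t| <= expR a * (t ^+ n.+1 * (a ^+ n.+1 / n.+1`!%:R)).
  move=> fg gb f00; rewrite ler_norml; apply/andP; split.
    have := @derive_ge0_le ((fun t => expR a * (t ^+ n.+1 * (a ^+ n.+1 / n.+1`!%:R))) + f)
      (fun s => b s + g s) _ _ t t01.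
    rewrite !fctE/= f00 expr0n/= mul0r mulr0 addr0 => h.
    rewrite lerNl -subr_ge0 opprK h// => s.
    by move=> /gb; rewrite ler_norml => /andP[]; lra.
  have := @derive_ge0_le ((fun t => expR a * (t ^+ n.+1 * (a ^+ n.+1 / n.+1`!%:R))) - f)
    (fun s => b s - g s) _ _ t t01.
  rewrite !fctE/= f00 expr0n/= mul0r mulr0 subr0 => h.
  rewrite -subr_ge0 h// => s.
  by move=> /gb; rewrite ler_norml => /andP[]; lra.
split.
  apply: (r0 _ _ (fun s => (is_derive_exp_remainder z n s).1)).
    move=> s s01; have [h1 h2] := IH s s01.
    exact: le_trans (ler_normB _ _) (key _ _ _ s01 h1 h2).
  rewrite /exp_remainder_Re !mulr0 expR0 cos0 mulr1 big_ord_recl big1.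
    by rewrite !expr0 mul1r fact0 divr1 addr0 subrr.
  by move=> i _; rewrite exprS !mul0r.
apply: (r0 _ _ (fun s => (is_derive_exp_remainder z n s).2)).
  move=> s s01; have [h1 h2] := IH s s01.
  exact: le_trans (ler_normD _ _) (key _ _ _ s01 h2 h1).
rewrite /exp_remainder_Im !mulr0 sin0 mulr0 big_ord_recl big1.
  by rewrite !expr0 mul1r mul0r addr0 subrr.
by move=> i _; rewrite exprS !mul0r.
Qed.

Lemma cexp_series z :
  (complex.Re (\sum_(k < n) z ^+ k / k`!%:R) @[n --> \oo] --> complex.Re (cexp z)) /\
  (complex.Im (\sum_(k < n) z ^+ k / k`!%:R) @[n --> \oo] --> complex.Im (cexp z)).
Proof.
pose a := `|complex.Re z| + `|complex.Im z|.
have Ea : expR a * (a ^+ n / n`!%:R) @[n --> \oo] --> 0.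
  rewrite -[X in _ --> X](mulr0 (expR a)); apply: cvgM; first exact: cvg_cst.
  exact/cvg_series_cvg_0/is_cvg_series_exp_coeff.
have b01 : 0 <= (1 : R) <= 1 by rewrite ler01 lexx.
have term k : z ^+ k / k`!%:R = z ^+ k * toC (k`!%:R^-1).
  by rewrite fmorphV rmorph_nat.
have conv (f : nat -> R) (l : R) :
    (forall n, `|l - f n| <= expR a * (1 ^+ n * (a ^+ n / n`!%:R))) ->
    f n @[n --> \oo] --> l.
  move=> fl; have h : `|f n - l| @[n --> \oo] --> (0 : R).
    have c0 : (fun=> 0 : R) n @[n --> \oo] --> (0 : R) by exact: cvg_cst.
    apply: (squeeze_cvgr _ c0 Ea); apply: nearW => n.
    by rewrite normr_ge0 distrC; have := fl n; rewrite expr1n mul1r.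
  exact: (subr_cvg0 _ _).1 (norm_cvg0 h).
have le n := exp_remainder_le z n b01.
split; apply: conv => n.
  apply: le_trans (le n).1; rewrite /exp_remainder_Re Re_sum !mulr1.
  rewrite le_eqVlt; apply/orP; left; apply/eqP; congr (`|_ - _|).
    by rewrite /cexp ReM/= mul0r subr0.
  by apply: eq_bigr => k _; rewrite term Re_mul_real expr1n mul1r.
apply: le_trans (le n).2; rewrite /exp_remainder_Im Im_sum !mulr1.
rewrite le_eqVlt; apply/orP; left; apply/eqP; congr (`|_ - _|).
  by rewrite /cexp ImM/= mul0r addr0.
by apply: eq_bigr => k _; rewrite term Im_mul_real expr1n mul1r.
Qed.

End complex_exponential.

(** * Convergence of moments and non-vanishing *)

Section moment_convergence.
Context {R : realType} {d : measure_display} {T : measurableType d}.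
Context (P : probability T R) (H : realHilbertType R) (W : H -> {RV P >-> R}).
Hypothesis HW : isonormal W.
Local Notation C := R[i].
Local Notation normc := (@ComplexField.Normc.normc R).
Local Notation toC := (real_complex R).
Local Notation intg F := (P.-integrable [set: T] (EFin \o F)).
Local Notation E F := (Rintegral P [set: T] F).
Local Notation cE := (cexpect P).
Local Notation RP := (real_chaos_polynomial W).
Local Notation CC := (chaos_closure W).

(** Transfer of [ler_dist_expr] from the norm of [R[i]], which takes values in
    [R[i]] itself, to the real-valued modulus. *)
Lemma normc_dist_expr (M : R) (a b : C) n : normc a <= M -> normc b <= M ->
  normc (a ^+ n - b ^+ n) <= n%:R * M ^+ n.-1 * normc (a - b).
Proof.
have nE z : `|z| = toC (normc z) by rewrite normc_def; case: z.
move=> aM bM; have := @ler_dist_expr C (toC M) a b n.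
rewrite !nE !lecR => /(_ aM bM).
by rewrite -(rmorph_nat toC) -rmorphXn -!rmorphM lecR.
Qed.

Lemma normc_sum_dist (I : finType) (a b : I -> C) :
  normc (\sum_i a i) <= \sum_i normc (a i - b i) + normc (\sum_i b i).
Proof.
have -> : \sum_i a i = \sum_i (a i - b i) + \sum_i b i by rewrite sumrB subrK.
by apply: (le_trans (le_normcD _ _)); rewrite lerD2r normc_sum.
Qed.

Lemma expect_dist_le (F G K : T -> R) : intg F -> intg G -> intg K ->
  (forall w, `|F w - G w| <= K w) -> `|E F - E G| <= E K.
Proof.
move=> iF iG iK FGK; rewrite ler_norml; apply/andP; split.
  rewrite lerNl opprB lerBlDr -expectD//; apply: expect_le => //.
    exact: integrable_addr.
  by move=> w; have := FGK w; rewrite ler_norml => /andP[]; lra.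
rewrite lerBlDr -expectD//; apply: expect_le => //.
  exact: integrable_addr.
by move=> w; have := FGK w; rewrite ler_norml => /andP[]; lra.
Qed.

Lemma cexpect_dist_le (Y Z : T -> C) (K : T -> R) :
  complex_all_moments P Y -> complex_all_moments P Z -> intg K ->
  (forall w, normc (Y w - Z w) <= K w) -> normc (cE Y - cE Z) <= 2 * E K.
Proof.
move=> [Y1 Y2] [Z1 Z2] iK YZK.
apply: (le_trans (normc_le_ReIm _)); rewrite mulr_natl mulr2n /cexpect/=.
apply: lerD; apply: expect_dist_le => //; try exact: moments_integrable; move=> w.
  by apply: le_trans (YZK w); apply: le_trans (normr_Re_le _); case: (Y w) (Z w) => ? ? [].
by apply: le_trans (YZK w); apply: le_trans (normr_Im_le _); case: (Y w) (Z w) => ? ? [].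
Qed.

Variables (n : nat) (X : 'I_n -> T -> R) (theta : 'I_n -> C).
Variables (t : 'I_n -> R) (S : R).
Hypothesis cX : forall k, CC (X k).
Hypothesis t0 : forall k, 0 < t k.
Hypothesis Xt : forall k, 2 * E (fun w => X k w ^+ 2) < t k ^+ 2.
Hypothesis S0 : 0 < S.
Hypothesis S1 : S < 1.
Hypothesis qtS : \sum_k normc (theta k) * t k < S.

Definition chaos_combination (V : 'I_n -> T -> R) (w : T) : C :=
  \sum_k theta k * toC (V k w).
Local Notation Z := (chaos_combination X).

Lemma chaos_combination_all_moments V : (forall k, all_moments P (V k)) ->
  complex_all_moments P (chaos_combination V).
Proof.
move=> aV; apply: cmoments_sum => k.
by apply: cmoments_mul; [exact: cmoments_cst|exact: cmoments_real].
Qed.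

Lemma chaos_combination_le V w :
  normc (chaos_combination V w) <= \sum_k normc (theta k) * `|V k w|.
Proof.
apply: (le_trans (normc_sum _ _)); apply: ler_sum => k _.
by rewrite ComplexField.Normc.normcM normc_real.
Qed.

Lemma chaos_combination_polynomial V : (forall k, RP (V k)) ->
  chaos_polynomial W (chaos_combination V).
Proof.
move=> rV; have -> : chaos_combination V = \sum_k theta k *: (fun w => toC (V k w)).
  by apply/funext => w; rewrite fct_sumE.
elim/big_ind : _ => [|f g cf cg|k _]; first exact: lincomb_of0.
  by have := lincomb_of_linear 1 cf cg; rewrite scale1r.
by have := lincomb_of_linear (theta k) (rV k) (lincomb_of0 _); rewrite addr0.
Qed.

Let Q : R := \sum_k normc (theta k).
Let Q0 : 0 <= Q. Proof. by apply: sumr_ge0 => k _; exact: normc_ge0. Qed.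
Let A : R := 1 + 2 / (1 - S ^+ 2).
Let M p : R := (p.-1 * 2)`!%:R * A.

Let A0 : 0 <= A.
Proof.
by rewrite addr_ge0// divr_ge0// subr_ge0 exprn_ile1// ltW.
Qed.

(** The errors [D = \sum_k |theta k| |X k - Y k|] are small in L^2, and
    [B = \sum_k |theta k| |X k| + D] dominates both combinations and has
    exponential moments by [family_exp], hence moments of all orders bounded by
    constants that do not depend on the approximation. The difference of the
    [p]-th powers is at most [p * B ^+ p.-1 * D], whose expectation is at most
    [eta] times a constant depending on [p] and [S] only. *)
Lemma moment_approximation eta : 0 < eta ->
  exists Z', [/\ chaos_polynomial W Z',
    2 * E (fun w => normc (Z' w) ^+ 2) <= S ^+ 2 &
    forall p, normc (cE (fun w => Z' w ^+ p) - cE (fun w => Z w ^+ p)) <=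
      2 * (p%:R * (eta * (1 + M p)))].
Proof.
move=> eta0.
pose gap := S - \sum_k normc (theta k) * t k.
have gap0 : 0 < gap by rewrite subr_gt0.
(* [e] bounds the L^2 errors of the components; [eta] controls the size of [D],
   and [gap] keeps the total weight of [B] below [S]. *)
pose e := Num.min eta gap / (Q + 1).
have Q1 : 0 < Q + 1 by move: Q0; lra.
have e0 : 0 < e by rewrite divr_gt0// lt_min eta0.
have Qe : Q * e <= Num.min eta gap.
  rewrite /e mulrCA ler_piMr//; first by rewrite le_min !ltW.
  by rewrite ler_pdivrMr// mul1r lerDl.
have Qeta : \sum_k normc (theta k) * e <= eta.
  by rewrite -mulr_suml (le_trans Qe)// ge_min lexx.
have Qgap : Q * e <= gap by rewrite (le_trans Qe)// ge_min lexx orbT.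
have /(_ _)/cid2 appr k : exists2 Y, RP Y & E (fun w => (X k w - Y w) ^+ 2) < e ^+ 2 / 2.
  by have [_ _ aX] := cX k; apply: aX; rewrite divr_gt0// exprn_gt0.
pose Y k := s2val (appr k).
have rY k : RP (Y k) := s2valP (appr k).
have cD k : CC (fun w => X k w - Y k w) by apply: chaos_closure_sub.
have De k : 2 * E (fun w => (X k w - Y k w) ^+ 2) < e ^+ 2.
  by have := s2valP' (appr k); rewrite -/(Y k); lra.
have aX k := chaos_closure_all_moments HW (cX k).
have aY k := real_chaos_polynomial_all_moments HW (rY k).
have aD k := chaos_closure_all_moments HW (cD k).
pose D w := \sum_k normc (theta k) * `|X k w - Y k w|.
have D0 w : 0 <= D w by apply: sumr_ge0 => k _; rewrite mulr_ge0// normc_ge0.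
have amD : all_moments P D.
  by apply: moments_sum => k; apply: moments_scale; apply: moments_norm.
have D2 : 2 * E (fun w => D w ^+ 2) <= eta ^+ 2.
  exact: (family_sqr cD (fun=> e0) De (fun k => normc_ge0 (theta k)) eta0 Qeta).
(* The family of the [X k] together with the errors, for which [B] is the
   weighted sum. *)
pose V (i : 'I_n + 'I_n) := match i with inl k => X k | inr k => (fun w => X k w - Y k w) end.
pose q (i : 'I_n + 'I_n) := match i with inl k => normc (theta k) | inr k => normc (theta k) end.
pose s (i : 'I_n + 'I_n) := match i with inl k => t k | inr k => e end.
pose B w := \sum_i q i * `|V i w|.
have BE w : B w = \sum_k normc (theta k) * `|X k w| + D w.
  by rewrite /B big_sumType.
have cV i : CC (V i) by case: i.
have s0 i : 0 < s i by case: i.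
have Vs i : 2 * E (fun w => V i w ^+ 2) < s i ^+ 2 by case: i.
have q0 i : 0 <= q i by case: i => k; exact: normc_ge0.
have qsS : \sum_i q i * s i <= S.
  by rewrite big_sumType/= -mulr_suml; move: Qgap; rewrite /gap /Q; lra.
have [iexp Eexp] := family_exp HW cV s0 Vs q0 S0 qsS S1.
have B2 : 2 * E (fun w => B w ^+ 2) <= S ^+ 2 by exact: (family_sqr cV s0 Vs q0 S0 qsS).
have B0 w : 0 <= B w by apply: sumr_ge0 => i _; rewrite mulr_ge0.
have amB : all_moments P B.
  apply: moments_sum => i; apply: moments_scale; apply: moments_norm.
  exact: (chaos_closure_all_moments HW (cV i)).
have ZB w : normc (Z w) <= B w.
  by apply: (le_trans (chaos_combination_le _ _)); rewrite BE lerDl.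
have YB w : normc (chaos_combination Y w) <= B w.
  apply: (le_trans (chaos_combination_le _ _)); rewrite BE /D -big_split/=.
  apply: ler_sum => k _; rewrite -mulrDr ler_wpM2l ?normc_ge0//.
  have := ler_normB (X k w) (X k w - Y k w); rewrite opprB addrC subrK.
  exact.
have YZ w : normc (chaos_combination Y w - Z w) <= D w.
  have -> : chaos_combination Y w - Z w = chaos_combination (fun k w => Y k w - X k w) w.
    by rewrite /chaos_combination -sumrB; apply: eq_bigr => k _; rewrite rmorphB mulrBr.
  apply: (le_trans (chaos_combination_le _ _)); apply: ler_sum => k _.
  by rewrite distrC.
have cZ := chaos_combination_all_moments aX; have cZ' := chaos_combination_all_moments aY.
exists (chaos_combination Y); split; first exact: chaos_combination_polynomial.
  apply: le_trans B2; rewrite ler_wpM2l// expect_le//.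
  - have [r1 r2] := cZ'.
    have := integrable_addr (r1.2 2) (r2.2 2); congr (P.-integrable _ _).
    by apply/funext => w; rewrite /= -normc_sqr.
  - exact: amB.2.
  - by move=> w; rewrite lerXn2r ?nnegrE ?normc_ge0.
move=> p; have i1 := integrable_scaler (2 * eta)^-1 (amD.2 2).
have i2 := integrable_scaler (eta / 2) (amB.2 (p.-1 * 2)).
have i3 := integrable_scaler p%:R (integrable_addr i1 i2).
apply: (le_trans (cexpect_dist_le (cmoments_pow p cZ') (cmoments_pow p cZ) i3 _)).
  move=> w; apply: (le_trans (normc_dist_expr p (YB w) (ZB w))).
  rewrite -mulrA ler_wpM2l//.
  apply: (@le_trans _ _ (B w ^+ p.-1 * D w)).
    by rewrite ler_wpM2l// exprn_ge0.
  rewrite exprM -subr_ge0 (_ : _ - _ = (2 * eta)^-1 * (D w - eta * B w ^+ p.-1) ^+ 2).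
    by rewrite mulr_ge0 ?sqr_ge0// invr_ge0 mulr_ge0// ltW.
  by field; rewrite gt_eqF.
rewrite ler_wpM2l// (expectZ _ (integrable_addr i1 i2)) ler_wpM2l// (expectD i1 i2).
rewrite (expectZ _ (amD.2 2)) (expectZ _ (amB.2 _)).
have -> : eta * (1 + M p) = eta + eta * M p by ring.
apply: lerD.
  apply: (@le_trans _ _ ((2 * eta)^-1 * eta ^+ 2)).
    apply: ler_wpM2l; first by rewrite invr_ge0 mulr_ge0// ltW.
    by have : 0 <= E (fun w => D w ^+ 2) by [apply: expect_ge0 => w; exact: sqr_ge0]; lra.
  have -> : (2 * eta)^-1 * eta ^+ 2 = eta / 2 by field; rewrite gt_eqF.
  by lra.
have BM : E (fun w => B w ^+ (p.-1 * 2)) <= M p.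
  apply: (@le_trans _ _ (E (fun w => (p.-1 * 2)`!%:R * expR (B w)))).
    apply: expect_le; [exact: amB.2|exact: integrable_scaler|].
    by move=> w; exact: exp_term_le.
  by rewrite expectZ// ler_wpM2l.
apply: (@le_trans _ _ (eta / 2 * M p)).
  by rewrite ler_wpM2l// divr_ge0// ltW.
rewrite ler_wpM2r ?mulr_ge0//; lra.
Qed.

(** The bound of [recursion_partial_sum_ge] depends on the approximating chaos
    polynomial only through [S], so it survives the passage to the limit. *)
Lemma chaos_partial_sum_ge (tau : R) N : 0 <= tau < 1 -> tau ^+ 2 = S ->
  (1 - S) * (1 - tau ^+ N.+1 / (1 - tau) ^+ 2) <=
  normc (\sum_(p < N.+1) cE (fun w => Z w ^+ p) / p`!%:R).
Proof.
move=> tau01 tauS.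
pose K := \sum_(p < N.+1) 2 * (p%:R * (1 + M p)).
have M0 p : 0 <= 1 + M p by rewrite addr_ge0// mulr_ge0.
have K0 : 0 <= K by apply: sumr_ge0 => p _; rewrite !mulr_ge0.
apply/ler_addgt0Pr => del del0.
have [|Z' [cZ' Z'S Zp]] := @moment_approximation (del / (K + 1)).
  by rewrite divr_gt0// ltr_wpDl.
have [c hc cs] := chaos_polynomial_recursion HW cZ'.
have := recursion_partial_sum_ge N tau01 hc.
rewrite tauS => /(_ (cs _ (ltW S0) Z'S)) hN; apply: (le_trans hN).
apply: (le_trans (normc_sum_dist _ (fun p : 'I_N.+1 =>
  cE (fun w => Z w ^+ p) / p`!%:R))); rewrite addrC lerD2l.
apply: (@le_trans _ _ (\sum_(p < N.+1) del / (K + 1) * (2 * (p%:R * (1 + M p))))).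
  apply: ler_sum => p _; rewrite -mulrBl ComplexField.Normc.normcM.
  rewrite ComplexField.Normc.normcV normc_natr.
  apply: (@le_trans _ _ (normc (cE (fun w => Z' w ^+ p) - cE (fun w => Z w ^+ p)))).
    by rewrite ler_piMr ?normc_ge0// invf_le1 ?ltr0n ?fact_gt0// ler1n fact_gt0.
  by apply: (le_trans (Zp p)); rewrite le_eqVlt; apply/orP; left; apply/eqP; ring.
rewrite -mulr_sumr -/K mulrAC ler_pdivrMr; last by rewrite ltr_wpDl.
by apply: ler_wpM2l; [exact: ltW|rewrite lerDl].
Qed.

(** The partial sums of the exponential series are dominated by
    [expR (\sum_k |theta k| |X k|)], so their expectations converge to that of
    [cexp Z]; by [chaos_partial_sum_ge] the limit has modulus at least [1 - S]. *)
Lemma cexpect_cexp_neq0 : cE (fun w => cexp (Z w)) <> 0.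
Proof.
have tau01 : 0 <= Num.sqrt S < 1.
  by rewrite sqrtr_ge0/= -(sqrtr1 R) ltr_sqrt.
have tauS : Num.sqrt S ^+ 2 = S by rewrite sqr_sqrtr// ltW.
set tau := Num.sqrt S in tau01 tauS; have /andP[tau0 tau1] := tau01.
have [iexp _] := family_exp HW cX t0 Xt (fun k => normc_ge0 (theta k)) S0 (ltW qtS) S1.
have cZ : complex_all_moments P Z.
  by apply: chaos_combination_all_moments => k; exact: (chaos_closure_all_moments HW (cX k)).
pose F N w := \sum_(p < N) Z w ^+ p / p`!%:R.
have cF N : complex_all_moments P (F N).
  by apply: cmoments_sum => p; apply: cmoments_mul; [exact: cmoments_pow|exact: cmoments_cst].
have EF N : cE (F N) = \sum_(p < N) cE (fun w => Z w ^+ p) / p`!%:R.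
  rewrite /F; under eq_fun do under eq_bigr do rewrite mulrC.
  rewrite cexpect_lincomb; last by move=> p; exact: cmoments_pow.
  by apply: eq_bigr => p _; rewrite mulrC.
have FG N w : normc (F N w) <= expR (\sum_k normc (theta k) * `|X k w|).
  apply: (@le_trans _ _ (expR (normc (Z w)))); last first.
    by rewrite ler_expR; exact: chaos_combination_le.
  apply: le_trans (exp_sum_le N (normc_ge0 (Z w))).
  apply: (le_trans (normc_sum _ _)); apply: ler_sum => p _.
  rewrite ComplexField.Normc.normcM ComplexField.Normc.normcV normc_natr.
  by rewrite normcX.
have mlim (f : nat -> T -> R) (g : T -> R) : (forall N, measurable_fun setT (f N)) ->
    (forall w, f N w @[N --> \oo] --> g w) -> measurable_fun setT g.
  by move=> mf fg; apply: (measurable_fun_cvg mf) => w _; exact: fg.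
have mF1 N : measurable_fun setT (fun w => complex.Re (F N w)) := (cF N).1.1.
have mF2 N : measurable_fun setT (fun w => complex.Im (F N w)) := (cF N).2.1.
have c1 w := (cexp_series (Z w)).1; have c2 w := (cexp_series (Z w)).2.
have l1 := expect_dominated_cvg mF1 (mlim _ _ mF1 c1) c1
  (fun N w => le_trans (normr_Re_le _) (FG N w)) iexp.
have l2 := expect_dominated_cvg mF2 (mlim _ _ mF2 c2) c2
  (fun N w => le_trans (normr_Im_le _) (FG N w)) iexp.
rewrite /cexpect => -[e1 e2]; move: l1 l2; rewrite e1 e2 => l1 l2.
have lhs : (1 - S) * (1 - tau ^+ N.+1 / (1 - tau) ^+ 2) @[N --> \oo] --> 1 - S.
  have h : tau ^+ N.+1 @[N --> \oo] --> 0.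
    have := @cvg_expr _ tau; rewrite ger0_norm// => /(_ tau1) h.
    by have := h; rewrite -cvg_shiftS.
  have h' : (1 - tau ^+ N.+1 / (1 - tau) ^+ 2) @[N --> \oo] --> 1 - 0 / (1 - tau) ^+ 2.
    by apply: cvgB; [exact: cvg_cst|exact: cvgMr_tmp].
  rewrite mul0r subr0 in h'; rewrite -[X in _ --> X]mulr1.
  by apply: cvgM => //; exact: cvg_cst.
have rhs : (`|E (fun w => complex.Re (F N.+1 w))| + `|E (fun w => complex.Im (F N.+1 w))|)
    @[N --> \oo] --> (0 : R).
  rewrite -[X in _ --> X](addr0 0) -{1}(normr0 R) -{2}(normr0 R).
  have l1' : E (fun w => complex.Re (F N.+1 w)) @[N --> \oo] --> (0 : R).
    by have := l1; rewrite -cvg_shiftS.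
  have l2' : E (fun w => complex.Im (F N.+1 w)) @[N --> \oo] --> (0 : R).
    by have := l2; rewrite -cvg_shiftS.
  by apply: cvgD; exact: cvg_norm.
have : 1 - S <= 0.
  apply: (ler_cvg_to lhs rhs); apply: nearW => N.
  apply: (le_trans (chaos_partial_sum_ge N tau01 tauS)).
  by rewrite -EF; exact: normc_le_ReIm.
by rewrite leNgt subr_gt0 S1.
Qed.

End moment_convergence.

(** * The second Wiener chaos *)

Section second_chaos.
Context {R : realType} {d : measure_display} {T : measurableType d}.
Context (P : probability T R) (H : realHilbertType R) (W : H -> {RV P >-> R}).
Local Notation intg F := (P.-integrable [set: T] (EFin \o F)).
Local Notation E F := (Rintegral P [set: T] F).
Local Notation toC := (real_complex R).

Lemma L2norm_expect_sqr (F : T -> R) (s : R) : measurable_fun setT F ->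
  L2norm P F = s%:E -> intg (fun w => F w ^+ 2) /\ E (fun w => F w ^+ 2) = s ^+ 2.
Proof.
move=> mF Fs; have := @poweR_Lnorm _ _ _ P (EFin \o F) 2 (lt0r_neq0 (ltr0n _ 2)).
rewrite [X in (X `^ _)%E]Fs poweR_EFin.
have s0 : 0 <= s by rewrite -lee_fin -Fs Lnorm_ge0.
have -> : (\int[P]_x `|(EFin \o F) x| `^ 2 = \int[P]_x (F x ^+ 2)%:E)%E.
  apply: eq_integral => w _; rewrite /= powR_mulrn//.
  by rewrite real_normK ?num_real.
rewrite powR_mulrn// => Es.
have iF : intg (fun w => F w ^+ 2).
  apply: (@integrable_of_integral_le _ _ _ _ _ (s ^+ 2)%:E) => //.
  - exact: measurable_funX.
  - by move=> w; exact: sqr_ge0.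
  - by rewrite -Es.
  - exact: ltry.
by split=> //; rewrite /Rintegral -Es.
Qed.

Lemma L2norm_fin (F : T -> R) (e : \bar R) : (L2norm P F < e)%E ->
  exists2 s, 0 <= s & L2norm P F = s%:E.
Proof.
move=> Fe; have F0 : (0 <= L2norm P F)%E by exact: Lnorm_ge0.
exists (fine (L2norm P F)); first exact: fine_ge0.
by rewrite fineK// ge0_fin_numE// (lt_le_trans Fe)// leey.
Qed.

Lemma second_chaos_closure (V : {RV P >-> R}) :
  second_chaos W V -> chaos_closure W V.
Proof.
move=> [Voo approx]; have [s _ Vs] := L2norm_fin Voo.
have [iV _] := L2norm_expect_sqr (measurable_funPT V) Vs.
split=> // e e0; have [|n [c [h [h1 hY]]]] := approx (Num.sqrt e).
  by rewrite sqrtr_gt0.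
exists (fun w => \sum_(i < n) c i * (W (h i) w ^+ 2 - 1)).
  exists n, (fun i => toC (c i)), (fun i w => toC (W (h i) w ^+ 2 - 1)).
  split; first by move=> i; exists (h i).
  apply/funext => w; rewrite fct_sumE rmorph_sum.
  by apply: eq_bigr => i _; rewrite rmorphM.
have [s' s'0 Ys] := L2norm_fin hY.
have [|_ ->] := L2norm_expect_sqr _ Ys.
  apply: measurable_funB => //; apply: measurable_sum => i.
  by apply: measurable_funM => //; apply: measurable_funB => //; exact: measurable_funX.
move: hY; rewrite Ys lte_fin => s'e.
by rewrite -(sqr_sqrtr (ltW e0)) ltrXn2r// nnegrE sqrtr_ge0.
Qed.

End second_chaos.

Lemma cexpectation_cexpect {R : realType} {d : measure_display} {T : measurableType d}
    (P : probability T R) (Z : T -> R[i]) : cexpectation P Z = cexpect P Z.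
Proof. by rewrite /cexpectation /cexpect unlock. Qed.

Section admissible_radii.
Context {R : realType} (n : nat) (q s : 'I_n -> R).
Hypothesis q0 : forall k, 0 <= q k.
Hypothesis s0 : forall k, 0 <= s k.

Lemma ereal_radii_lt (r : 'I_n -> \bar R) (b : R) :
  (forall k, ((q k)%:E < r k)%E) -> (\sum_(k < n) r k * (s k)%:E < b%:E)%E ->
  \sum_k q k * s k < b.
Proof.
move=> qr rb; rewrite -lte_fin; apply: le_lt_trans rb.
rewrite -sumEFin; apply: lee_sum => k _.
by rewrite EFinM lee_wpmul2r ?lee_fin// ltW.
Qed.

(** Half of the gap [1 - Num.sqrt 2 * \sum_k q k * s k] separates [S] from 1; the
    other half allows each [Num.sqrt 2 * s k] to be enlarged by the same [e], which
    also makes [t k] positive when [s k = 0]. *)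
Lemma radii_margin : \sum_k q k * s k < (Num.sqrt 2)^-1 ->
  exists t : 'I_n -> R, exists S : R,
    [/\ forall k, 0 < t k, forall k, 2 * s k ^+ 2 < t k ^+ 2,
        0 < S, S < 1 & \sum_k q k * t k < S].
Proof.
set c := Num.sqrt 2; have c0 : 0 < c by rewrite sqrtr_gt0.
have c2 : c ^+ 2 = 2 by rewrite sqr_sqrtr.
rewrite -(ltr_pM2l c0) divff ?gt_eqF//; set a := c * _ => a1.
have a0 : 0 <= a.
  by apply: mulr_ge0; [exact: ltW|apply: sumr_ge0 => k _; exact: mulr_ge0].
pose Q := \sum_k q k; have Q0 : 0 <= Q by exact: sumr_ge0.
pose e := (1 - a) / (4 * (Q + 1)).
have Q1 : 0 < Q + 1 by rewrite ltr_wpDl.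
have e0 : 0 < e by rewrite divr_gt0 ?subr_gt0// mulr_gt0.
have Qe : Q * e <= (1 - a) / 4.
  have -> : (1 - a) / 4 = (Q + 1) * e by rewrite /e; field; rewrite gt_eqF.
  by rewrite ler_wpM2r ?ltW// ltrDl.
exists (fun k => c * s k + e), ((1 + a) / 2).
have cs0 k : 0 <= c * s k by rewrite mulr_ge0// ltW.
split.
- by move=> k; rewrite ltr_wpDl.
- by move=> k; rewrite -c2 -exprMn ltrXn2r ?nnegrE ?addr_ge0 ?ltrDl// ltW.
- by lra.
- by lra.
- have -> : \sum_k q k * (c * s k + e) = a + Q * e.
    rewrite /a /Q mulr_sumr mulr_suml -big_split/=.
    by apply: eq_bigr => k _; ring.
  by lra.
Qed.

End admissible_radii.

Unset Implicit Arguments.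

Theorem proposition4p9 (R : realType)
    (H : realHilbertType R) (Hsep : separable_space H)
    (T : realHilbertType R) (tens : H -> H -> T)
    (HT : is_hilbert_tensor_square tens)
    (dOmega : measure_display) (Omega : measurableType dOmega)
    (P : probability Omega R)
    (W : H -> {RV P >-> R}) (HW : isonormal W)
    (I2 : T -> {RV P >-> R}) (HI2 : is_second_wiener_isometry tens W I2)
    (d : nat) (f : 'I_d -> T)
    (Hf : forall k : 'I_d, symmetric_tensor tens (f k))
    (r : 'I_d -> \bar R) (Hr : forall k : 'I_d, (0 < r k)%E)
    (Hrf : (\sum_(k < d) r k * (sym_norm (f k))%:E <
              ((Num.sqrt (2 : R))^-1)%:E)%E) :
  let X := fun k : 'I_d => I2 (f k) in
  mgf_defined_on_polydisc X r /\
  (forall theta : 'I_d -> R[i], polydisc r theta -> mgf X theta <> 0).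
Proof.
move=> X; have [_ I2norm I2chaos _ _] := HI2.
have cX k : chaos_closure W (X k) := second_chaos_closure (I2chaos _ (Hf k)).
have s0 k : 0 <= sym_norm (f k) by rewrite mulr_ge0// sqrtr_ge0.
have X2 k : Rintegral P setT (fun w => X k w ^+ 2) = sym_norm (f k) ^+ 2.
  exact: (L2norm_expect_sqr (measurable_funPT (X k)) (I2norm _ (Hf k))).2.
split=> [q q0r|theta theta_r].
  have q0 k : 0 <= q k := (q0r k).1.
  have [t [S [t0 st S0 S1 qtS]]] :=
    radii_margin q0 s0 (ereal_radii_lt s0 (fun k => (q0r k).2) Hrf).
  have Xt k : 2 * Rintegral P setT (fun w => X k w ^+ 2) < t k ^+ 2.
    by rewrite X2.
  have [iexp _] := family_exp HW cX t0 Xt q0 S0 (ltW qtS) S1.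
  by rewrite unlock expect_fine// ltry.
have q0 k : 0 <= ComplexField.Normc.normc (theta k) := normc_ge0 _.
have [t [S [t0 st S0 S1 qtS]]] :=
  radii_margin q0 s0 (ereal_radii_lt s0 theta_r Hrf).
have Xt k : 2 * Rintegral P setT (fun w => X k w ^+ 2) < t k ^+ 2.
  by rewrite X2.
rewrite /mgf cexpectation_cexpect.
exact: (cexpect_cexp_neq0 HW cX t0 Xt S0 S1 qtS).
Qed.
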